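(* For an $(M,K)$ reversely degraded broadcast channel, the common-message-secrecy-capacity is $$C^{\mathrm{common}}_{K,M}=\max_{\prod_{j=1}^M p(x_j)}\ \min_{i\in\{1,\dots,K\}}\ \sum_{j=1}^M I(X_j;Y_{ij}\mid Y_{ej}).$$
   Context: An $(M,K)$ product broadcast channel: one sender, $K$ intended receivers, one eavesdropper (index $e$), and $M$ parallel channels with finite input alphabet $\mathcal{X}$ and finite output alphabet $\mathcal{Y}$, memoryless and mutually independent: $\Pr(\{y_{1j}^n,\dots,y_{Kj}^n,y_{ej}^n\}_{j=1}^M\mid\{x_j^n\}_{j=1}^M)=\prod_{j=1}^M\prod_{t=1}^n \Pr(y_{1j}(t),\dots,y_{Kj}(t),y_{ej}(t)\mid x_j(t))$. It is reversely degraded if for each channel $j$ there is a permutation $\pi_j(1),\dots,\pi_j(K+1)$ of $\{1,\dots,K,e\}$ such that $X_j\to Y_{\pi_j(1)j}\to Y_{\pi_j(2)j}\to\cdots\to Y_{\pi_j(K+1)j}$ is a Markov chain (the order may differ across channels); mutual informations are evaluated under this channel law. An $(n,2^{nR})$ code consists of a message set $\{1,\dots,2^{nR}\}$, a possibly stochastic encoder mapping a message $W$ to $(x_1^n,\dots,x_M^n)$, and decoders producing $\hat W_i$ from $(y_{i1}^n,\dots,y_{iM}^n)$, $i=1,\dots,K$. A rate $R$ is an achievable common-message-secrecy-rate if for every $\varepsilon>0$ there is a length-$n$ code with $\Pr(W\neq\hat W_i)\le\varepsilon$ for all $i$ and $\frac1n H(W\mid Y_{e1}^n,\dots,Y_{eM}^n)\ge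 R-\varepsilon$; the common-message-secrecy-capacity is the supremum of achievable rates. *)

(* Defs.v *)
From HB Require Import structures.
From mathcomp Require Import all_boot all_order all_algebra all_fingroup.
From mathcomp Require Import reals exp.

Set Implicit Arguments.
Unset Strict Implicit.
Unset Printing Implicit Defensive.

Import Order.TTheory GRing.Theory Num.Theory.
Local Open Scope ring_scope.

Section ProductBC.
Variable R : realType.

Definition log2 (x : R) : R := ln x / ln 2.

Definition is_pmf (T : finType) (p : {ffun T -> R}) : Prop :=
  (forall t, 0 <= p t) /\ \sum_t p t = 1.

Variables (X Y : finType) (K M : nat).

(* Receivers are indexed by 'I_K.+1: indices 0..K-1 are the K intended
   receivers, the last index (ord_max = K) is the eavesdropper e. *)
Definition eve : 'I_K.+1 := ord_max.
Definition rcv (i : 'I_K) : 'I_K.+1 := widen_ord (leqnSn K) i.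

Definition outsym := {ffun 'I_K.+1 -> Y}.

(* The M component channels: W j x is the law of (Y_1j,...,Y_Kj,Y_ej) given X_j = x *)
Definition channel := 'I_M -> X -> {ffun outsym -> R}.

Definition is_channel (W : channel) : Prop := forall j x, is_pmf (W j x).

(* Reversely degraded: for every channel j there is a permutation pi_j of
   {1,...,K,e} such that X_j -> Y_{pi_j(1) j} -> ... -> Y_{pi_j(K+1) j} is a
   Markov chain, i.e. the channel law factorizes through stochastic kernels
   q_k(y_{pi(k+1)} | y_{pi(k)}) not depending on the input. *)
Definition rev_degraded (W : channel) : Prop :=
  forall j : 'I_M, exists (pi : {perm 'I_K.+1}) (q : 'I_K -> Y -> {ffun Y -> R}),
    (forall k y, is_pmf (q k y)) /\
    forall (x : X) (y : outsym),
      W j x y =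
        (\sum_(y' : outsym | y' (pi ord0) == y (pi ord0)) W j x y') *
        \prod_(k < K) q k (y (pi (inord k))) (y (pi (inord k.+1))).

Definition inword (n : nat) := {ffun 'I_M -> {ffun 'I_n -> X}}.
Definition outword (n : nat) := {ffun 'I_M -> {ffun 'I_n -> outsym}}.
Definition obsword (n : nat) := {ffun 'I_M -> {ffun 'I_n -> Y}}.

Definition observe (n : nat) (k : 'I_K.+1) (y : outword n) : obsword n :=
  [ffun j => [ffun t => y j t k]].

Definition chan_n (W : channel) (n : nat) (x : inword n) (y : outword n) : R :=
  \prod_(j < M) \prod_(t < n) W j (x j t) (y j t).

Definition nmsg (n : nat) (r : R) : nat := `|Num.ceil (2 `^ (n%:R * r))|%N.

(* joint law of (W, X^n, Y^n), W uniform on the message set 'I_N *)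
Definition code_joint (W : channel) (n N : nat)
  (enc : 'I_N -> {ffun inword n -> R}) (w : 'I_N) (x : inword n) (y : outword n) : R :=
  N%:R^-1 * enc w x * chan_n W x y.

Definition err_prob (W : channel) (n N : nat)
  (enc : 'I_N -> {ffun inword n -> R}) (dec : 'I_K -> obsword n -> 'I_N) (i : 'I_K) : R :=
  \sum_(w : 'I_N) \sum_(x : inword n) \sum_(y : outword n)
     (if dec i (observe (rcv i) y) != w then code_joint W enc w x y else 0).

Definition condH (A B : finType) (p : A -> B -> R) : R :=
  - \sum_(a : A) \sum_(b : B)
      (if p a b == 0 then 0 else p a b * log2 (p a b / \sum_(a' : A) p a' b)).

Definition msg_eve (W : channel) (n N : nat)
  (enc : 'I_N -> {ffun inword n -> R}) (w : 'I_N) (z : obsword n) : R :=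
  \sum_(x : inword n) \sum_(y : outword n | observe eve y == z) code_joint W enc w x y.

Definition achievable (W : channel) (r : R) : Prop :=
  forall eps : R, 0 < eps ->
    exists n : nat, (0 < n)%N /\
    exists (enc : 'I_(nmsg n r) -> {ffun inword n -> R})
           (dec : 'I_K -> obsword n -> 'I_(nmsg n r)),
      (forall w, is_pmf (enc w)) /\
      (forall i, err_prob W enc dec i <= eps) /\
      r - eps <= condH (msg_eve W enc) / n%:R.

Definition is_secrecy_capacity (W : channel) (C : R) : Prop :=
  (forall r, achievable W r -> r <= C) /\
  (forall C', (forall r, achievable W r -> r <= C') -> C <= C').

Definition condMI (T1 T2 T3 : finType) (q : T1 -> T2 -> T3 -> R) : R :=
  \sum_(a : T1) \sum_(b : T2) \sum_(c : T3)
    (if q a b c == 0 then 0 else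
       q a b c * log2 (q a b c * (\sum_(a' : T1) \sum_(b' : T2) q a' b' c) /
                       ((\sum_(b' : T2) q a b' c) * (\sum_(a' : T1) q a' b c)))).

Definition joint_xyz (W : channel) (j : 'I_M) (px : {ffun X -> R}) (i : 'I_K)
  (x : X) (a b : Y) : R :=
  px x * \sum_(y : outsym | (y (rcv i) == a) && (y eve == b)) W j x y.

(* minimum of a finite family (meaningful when the index type is nonempty) *)
Definition minI (N : nat) (f : 'I_N -> R) : R :=
  let s := [seq f i | i : 'I_N] in \big[Num.min/head 0 s]_(v <- s) v.

Definition secrecy_objective (W : channel) (p : 'I_M -> {ffun X -> R}) : R :=
  minI (fun i : 'I_K => \sum_(j < M) condMI (joint_xyz W j (p j) i)).

End ProductBC.

(* Main.v *)
Require Import Defs.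
From HB Require Import structures.
From mathcomp Require Import all_boot all_order all_algebra all_fingroup.
From mathcomp Require Import reals exp.
From mathcomp Require Import ring lra.
From mathcomp Require Import boolp classical_sets topology normedtype sequences derive realfun.

Set Implicit Arguments.
Unset Strict Implicit.
Unset Printing Implicit Defensive.

Import Order.TTheory GRing.Theory Num.Theory.
Import numFieldNormedType.Exports.
Local Open Scope ring_scope.

(** Achievability. In each channel [j] every message owns a bin of about
    [2^(n I(X_j;Y_ej))] random words, and the encoder draws the word of each channel
    independently from the bin of the message. By soft covering, the law of the
    eavesdropper's output given the message is within [o(n)] (in divergence) of a fixed
    product law, which bounds the leakage. Receiver [i] only uses the channels in which it
    precedes the eavesdropper in the degradation order: there a wrong bin looks plausible
    with probability about [2^(-n (I(X_j;Y_ij) - I(X_j;Y_ej)))], so rates below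
    [\sum_j I(X_j;Y_ij|Y_ej)] are decodable; in the other channels the conditional mutual
    information vanishes.

    Converse. A single use of [ln r <= r - 1] bounds the equivocation by Fano's term plus
    [n \sum_j I(X_j;Y_ij|Y_ej)] evaluated at the time-averaged input laws, which do not
    depend on the receiver.

    The maximum exists because the objective is continuous on a product of simplices. *)

(** * Sums over product spaces *)

(** One code must serve all receivers, although each has its own set of useful channels. The bin
    indices of different channels are therefore drawn independently: a receiver that skips a channel
    does not pay for the randomness spent there, and the leakage is a sum over channels. Decoding
    tests a whole bin through the likelihood ratio of its mixture law and never recovers the word
    drawn from it; a wrong bin has mean ratio at most 1, so Markov's inequality and a union bound
    over the messages suffice. All concentration comes from the variance of the information density,
    which is enough since the leakage only has to be small after division by the length. In the
    converse, [achievable] grants for each [eps] some length that may stay small, so the constant in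
    Fano's inequality cannot be absorbed by the length. The guess of the message carries a free
    parameter [del] instead: [del] is fixed first, to make [- ln (1 - del)] small, and [eps]
    afterwards, to make its product with [- ln del] small. Estimates are in nats; [ln 2] converts
    them to bits. *)

Section ProductSums.
Variables (R : realType) (I : finType).

Lemma sum_prod_marginal (T S : finType) (g : I -> T -> R) (f : I -> T -> S)
    (s : {ffun I -> S}) :
  \sum_(u : {ffun I -> T} | [ffun j => f j (u j)] == s) \prod_j g j (u j) =
  \prod_j \sum_(v | f j v == s j) g j v.
Proof.
rewrite bigA_distr_big_dep; apply: eq_bigl => u.
apply/eqP/familyP => [<- j|h]; first by rewrite unfold_in /= ffunE.
by apply/ffunP => j; rewrite ffunE; have := h j; rewrite unfold_in => /eqP.
Qed.

Variables (T : finType) (p : I -> T -> R).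
Hypothesis p1 : forall i, \sum_t p i t = 1.

Lemma expect_prod (F : I -> T -> R) :
  \sum_(u : {ffun I -> T}) (\prod_j p j (u j)) * \prod_j F j (u j) =
  \prod_j \sum_t p j t * F j t.
Proof.
rewrite bigA_distr_bigA; apply: eq_bigr => u _.
by rewrite big_split.
Qed.

Lemma sum_prod1 : \sum_(u : {ffun I -> T}) \prod_j p j (u j) = 1.
Proof. by rewrite -bigA_distr_bigA big1 // => i _. Qed.

Lemma expect_coord (i : I) (F : T -> R) :
  \sum_(u : {ffun I -> T}) (\prod_j p j (u j)) * F (u i) = \sum_t p i t * F t.
Proof.
transitivity (\sum_(u : {ffun I -> T})
    (\prod_j p j (u j)) * \prod_j (if j == i then F (u j) else 1)).
  apply: eq_bigr => u _; congr (_ * _).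
  by rewrite -big_mkcond big_pred1_eq.
rewrite (expect_prod (fun j t => if j == i then F t else 1)) (bigD1 i) //= eqxx.
rewrite [X in _ * X]big1 ?mulr1 // => j /negPf ->.
by rewrite -mulr_suml p1 mul1r.
Qed.

Lemma expect_coord2 (i k : I) (F G : T -> R) : i != k ->
  \sum_(u : {ffun I -> T}) (\prod_j p j (u j)) * (F (u i) * G (u k)) =
  (\sum_t p i t * F t) * (\sum_t p k t * G t).
Proof.
move=> ik.
pose H j t := if j == i then F t else if j == k then G t else 1.
transitivity (\sum_(u : {ffun I -> T})
    (\prod_j p j (u j)) * \prod_j H j (u j)).
  apply: eq_bigr => u _; congr (_ * _).
  rewrite (bigD1 i) // (bigD1 k) ?(eq_sym k) //= /H eqxx (eq_sym k) (negPf ik) eqxx big1 ?mulr1 //.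
  by move=> j /andP[/negPf -> /negPf ->].
rewrite expect_prod (bigD1 i) // (bigD1 k) ?(eq_sym k) //= /H eqxx (eq_sym k) (negPf ik) eqxx.
rewrite [X in _ * (_ * X)]big1 ?mulr1 // => j /andP[/negPf -> /negPf ->].
by rewrite -mulr_suml p1 mul1r.
Qed.

(** Distinct coordinates are independent and centered, so the cross terms of the square vanish. *)
Lemma variance_sum (f : I -> T -> R) :
  (forall i, \sum_t p i t * f i t = 0) ->
  \sum_(u : {ffun I -> T}) (\prod_j p j (u j)) * (\sum_i f i (u i)) ^+ 2 =
  \sum_i \sum_t p i t * f i t ^+ 2.
Proof.
move=> f0.
transitivity (\sum_(u : {ffun I -> T}) \sum_i \sum_k
    (\prod_j p j (u j)) * (f i (u i) * f k (u k))).
  apply: eq_bigr => u _; rewrite expr2 mulr_suml mulr_sumr.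
  by apply: eq_bigr => i _; rewrite mulr_sumr mulr_sumr.
rewrite exchange_big /=; apply: eq_bigr => i _.
rewrite exchange_big /= (bigD1 i) //= [X in _ + X]big1 ?addr0.
  apply: etrans (expect_coord i (fun t => f i t * f i t)) _.
  by apply: eq_bigr => t _; rewrite expr2.
move=> k ki.
by apply: etrans (expect_coord2 (f i) (f k) _) _; rewrite 1?eq_sym // !f0 mulr0.
Qed.

End ProductSums.

Section Pairs.
Variables (R : realType) (I A B : finType).

(** A pair of words is a word of pairs; an input word together with its memoryless output then
    follows a product law, to which the lemmas above apply. *)
Lemma sum_ffun_pair (F : {ffun I -> A} -> {ffun I -> B} -> R) :
  \sum_x \sum_y F x y =
  \sum_(z : {ffun I -> A * B}) F [ffun i => (z i).1] [ffun i => (z i).2].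
Proof.
rewrite pair_big /= (reindex (fun z : {ffun I -> A * B} =>
  ([ffun i => (z i).1], [ffun i => (z i).2]))) //=.
exists (fun xy : {ffun I -> A} * {ffun I -> B} => [ffun i => (xy.1 i, xy.2 i)]) => [z _|[x y] _] /=.
  by apply/ffunP => i; rewrite !ffunE -surjective_pairing.
by congr pair; apply/ffunP => i; rewrite !ffunE.
Qed.

Variables (p : I -> A -> R) (V : I -> A -> B -> R).
Hypothesis p1 : forall i, \sum_a p i a = 1.
Hypothesis V1 : forall i a, \sum_b V i a b = 1.

Lemma sum_joint1 i : \sum_(z : A * B) p i z.1 * V i z.1 z.2 = 1.
Proof.
rewrite -(pair_big predT predT (fun a b => p i a * V i a b)) /=.
by rewrite -(p1 i); apply: eq_bigr => a _; rewrite -mulr_sumr V1 mulr1.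
Qed.

Lemma expect_joint_coord (i : I) (F : A -> B -> R) :
  \sum_(x : {ffun I -> A}) \sum_(y : {ffun I -> B})
    (\prod_j p j (x j)) * (\prod_j V j (x j) (y j)) * F (x i) (y i) =
  \sum_a \sum_b p i a * V i a b * F a b.
Proof.
rewrite sum_ffun_pair (pair_big predT predT (fun a b => p i a * V i a b * F a b)) /=.
rewrite -(expect_coord sum_joint1 i (fun z => F z.1 z.2)).
apply: eq_bigr => z _; rewrite -big_split /= !ffunE; congr (_ * _).
by apply: eq_bigr => j _; rewrite !ffunE.
Qed.

Lemma variance_joint (f : I -> A -> B -> R) :
  (forall i, \sum_a \sum_b p i a * V i a b * f i a b = 0) ->
  \sum_(x : {ffun I -> A}) \sum_(y : {ffun I -> B})
    (\prod_j p j (x j)) * (\prod_j V j (x j) (y j)) *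
    (\sum_i f i (x i) (y i)) ^+ 2 =
  \sum_i \sum_a \sum_b p i a * V i a b * f i a b ^+ 2.
Proof.
move=> f0.
rewrite sum_ffun_pair.
under [RHS]eq_bigr => i _ do
  rewrite (pair_big predT predT (fun a b => p i a * V i a b * f i a b ^+ 2)) /=.
rewrite -(variance_sum sum_joint1 (f := fun i z => f i z.1 z.2)); last first.
  by move=> i; rewrite -(pair_big predT predT (fun a b => p i a * V i a b * f i a b)).
apply: eq_bigr => z _; rewrite -big_split /=.
congr (_ * _ ^+ 2); last by apply: eq_bigr => j _; rewrite !ffunE.
by apply: eq_bigr => j _; rewrite !ffunE.
Qed.

End Pairs.

(** * Inequalities for the logarithm *)

Section Logarithm.
Variable R : realType.
Implicit Types x y : R.

Lemma ln_le_sub1 x : 0 < x -> ln x <= x - 1.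
Proof.
move=> x0; have := @le_ln1Dx R (x - 1); rewrite addrCA subrr addr0; apply.
by lra.
Qed.

Lemma ln2_gt0 : 0 < ln 2 :> R.
Proof. by apply: ln_gt0; lra. Qed.

Lemma ln_prod (I : finType) (P : pred I) (F : I -> R) : (forall i, P i -> 0 < F i) ->
  ln (\prod_(i | P i) F i) = \sum_(i | P i) ln (F i).
Proof.
move=> F0.
suff: 0 < \prod_(i | P i) F i /\ ln (\prod_(i | P i) F i) = \sum_(i | P i) ln (F i) by case.
elim/big_rec2: _ => [|i y1 y2 Pi [y20 <-]]; first by rewrite ln1.
by rewrite mulr_gt0 ?F0 // lnM ?posrE ?F0.
Qed.

(* Gibbs' inequality. *)
Lemma sum_ln_le0 (T : finType) (p r : T -> R) : (forall t, 0 <= p t) ->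
  (forall t, 0 < p t -> 0 < r t) -> \sum_t p t * r t <= \sum_t p t ->
  \sum_t p t * ln (r t) <= 0.
Proof.
move=> p0 r0 le.
have: \sum_t p t * ln (r t) <= \sum_t (p t * r t - p t).
  apply: ler_sum => t _.
  have [->|pt] := eqVneq (p t) 0; first by rewrite !mul0r subrr.
  rewrite -[X in _ - X]mulr1 -mulrBr ler_wpM2l // ln_le_sub1 // r0 //.
  by rewrite lt_def pt p0.
by move/le_trans; apply; rewrite sumrB subr_le0.
Qed.

(** Follows from [s ^+ 2 - c * |s| + c ^+ 2 >= 0]. It trades an absolute first moment for a
    variance. *)
Lemma abs_le_quad (c s : R) : 0 < c -> `|s| <= c + s ^+ 2 / c.
Proof.
move=> c0; rewrite -(ler_pM2r c0) mulrDl divfK ?gt_eqF //.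
rewrite -(real_normK (num_real s)); have := normr_ge0 s; nra.
Qed.

End Logarithm.

(** * Random coding and soft covering *)

(** Besides the bound, the witness has positive weight: a codebook chosen this way lies in the
    support of its law, where the logarithms of its likelihood ratios split. *)
Lemma exists_le_mean (R : realType) (T : finType) (p F : T -> R) (b : R) :
  (forall t, 0 <= p t) -> \sum_t p t = 1 -> \sum_t p t * F t <= b ->
  exists t, 0 < p t /\ F t <= b.
Proof.
move=> p0 p1 le.
case: (boolP [exists t, (0 < p t) && (F t <= b)]) => [/existsP[t /andP[]]|].
  by exists t.
move=> /existsPn h; exfalso.
have h' t : 0 < p t -> b < F t.
  by move=> pt; have := h t; rewrite pt /= -ltNge.
have [t pt] : exists t, 0 < p t.
  apply/existsP; apply: contraT => /existsPn n; move: p1.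
  rewrite big1 => [/eqP|t _]; first by rewrite eq_sym oner_eq0.
  by apply/eqP; rewrite eq_le p0 leNgt n.
have: 0 < \sum_t p t * (F t - b).
  rewrite (bigD1 t) //= ltr_pwDl ?mulr_gt0 ?subr_gt0 ?h' // sumr_ge0 // => i _.
  have [->|pi] := eqVneq (p i) 0; first by rewrite mul0r.
  by rewrite mulr_ge0 // subr_ge0 ltW // h' // lt_def pi p0.
under eq_bigr => i _ do rewrite mulrBr.
by rewrite sumrB -mulr_suml p1 mul1r subr_gt0 ltNge le.
Qed.

Section RandomCoding.
Variables (R : realType) (U B : finType) (PU : U -> R).
Hypotheses (PU0 : forall u, 0 <= PU u) (PU1 : \sum_u PU u = 1).

(** Any message above the threshold will do; [w0] fills in when none passes. *)
Definition threshold_dec (N : nat) (w0 : 'I_N) (s : U -> B -> R) (T : R)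
    (c : {ffun 'I_N -> U}) (b : B) : 'I_N :=
  odflt w0 [pick w | T < s (c w) b].

(** In case of error, either the true score is at most [T], or some wrong message passes the test
    and its score over [T] exceeds 1: Markov's inequality before averaging. *)
Lemma threshold_dec_err (N : nat) (w0 : 'I_N) (s : U -> B -> R) (T : R)
    (c : {ffun 'I_N -> U}) (b : B) (w : 'I_N) : 0 < T -> (forall u, 0 <= s u b) ->
  (threshold_dec w0 s T c b != w)%:R <=
  (s (c w) b <= T)%R%:R + \sum_(w' | w' != w) s (c w') b / T.
Proof.
move=> T0 s0.
have sT0 v : 0 <= s (c v) b / T by rewrite divr_ge0 // ltW.
have [le|gt] /= := leP (s (c w) b) T.
  by rewrite -[X in X <= _]addr0 lerD ?sumr_ge0 // lern1 leq_b1.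
rewrite add0r /threshold_dec; case: pickP => [v Tv|/(_ w)]; last by rewrite gt.
rewrite /=; have [_|vw] := eqVneq v w; first by rewrite sumr_ge0.
rewrite (bigD1 v) //= -[X in X <= _]addr0 lerD ?sumr_ge0 //.
by rewrite ler_pdivlMr // mul1r ltW.
Qed.

(** The word of a wrong message is independent of the output, so its score averages to at most 1 and
    each of the [N.-1] competitors contributes at most [T^-1]. *)
Lemma random_coding_err (N : nat) (w0 : 'I_N) (V s : U -> B -> R) (T : R) :
  (forall u b, 0 <= V u b) -> (forall u, \sum_b V u b = 1) ->
  (forall u b, 0 <= s u b) -> (forall b, \sum_u PU u * s u b <= 1) -> 0 < T ->
  \sum_(c : {ffun 'I_N -> U}) (\prod_w PU (c w)) *
    (N%:R^-1 * \sum_w \sum_b (threshold_dec w0 s T c b != w)%:R * V (c w) b) <=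
  \sum_u \sum_b PU u * V u b * (s u b <= T)%R%:R + N.-1%:R / T.
Proof.
move=> V0 V1 s0 s1 T0.
have PC0 (c : {ffun 'I_N -> U}) : 0 <= \prod_w PU (c w) by apply: prodr_ge0.
have N0 : (0 < N)%N by case: w0 => m; apply: leq_ltn_trans.
set D := \sum_u _.
have key (w : 'I_N) : \sum_(c : {ffun 'I_N -> U}) (\prod_w PU (c w)) *
    (\sum_b (threshold_dec w0 s T c b != w)%:R * V (c w) b) <= D + N.-1%:R / T.
  apply: (@le_trans _ _ (\sum_(c : {ffun 'I_N -> U}) (\prod_w PU (c w)) *
      (\sum_b ((s (c w) b <= T)%R%:R * V (c w) b +
        \sum_(w' | w' != w) V (c w) b * s (c w') b / T)))).
    apply: ler_sum => c _; rewrite ler_wpM2l //; apply: ler_sum => b _.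
    apply: le_trans (ler_wpM2r (V0 _ _) (threshold_dec_err _ _ _ T0 _)) _ => //.
    rewrite mulrDl lerD // mulr_suml ler_sum // => w' _.
    by rewrite mulrC mulrA.
  under eq_bigr => c _ do rewrite big_split mulrDr.
  rewrite big_split /= lerD //.
    rewrite (expect_coord (fun=> PU1) w (fun u => \sum_b (s u b <= T)%R%:R * V u b)).
    rewrite /D le_eqVlt; apply/orP; left; apply/eqP; apply: eq_bigr => u _.
    by rewrite mulr_sumr; apply: eq_bigr => b _; rewrite mulrCA mulrA mulrC mulrA mulrC mulrA.
  under eq_bigr => c _ do rewrite exchange_big /= mulr_sumr.
  rewrite exchange_big /=.
  apply: (@le_trans _ _ (\sum_(w' < N | w' != w) T^-1)); last first.
    by rewrite (sumr_const (predC1 w)) cardC1 card_ord mulr_natl.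
  apply: ler_sum => w' w'w.
  under eq_bigr => c _ do rewrite mulr_sumr.
  rewrite exchange_big /=.
  apply: (@le_trans _ _ (\sum_b (\sum_u PU u * V u b) / T)).
    apply: ler_sum => b _.
    under eq_bigr => c _ do rewrite mulrA.
    rewrite -mulr_suml ler_wpM2r ?invr_ge0 ?(ltW T0) //.
    rewrite (expect_coord2 (fun=> PU1) (fun u => V u b) (fun u => s u b)) 1?eq_sym //.
    rewrite -[X in _ <= X]mulr1 ler_wpM2l //.
    by apply: sumr_ge0 => u _; rewrite mulr_ge0.
  rewrite -mulr_suml exchange_big /=.
  under eq_bigr => u _ do rewrite -mulr_sumr V1 mulr1.
  by rewrite PU1 mul1r.
under eq_bigr => c _ do rewrite mulrCA mulr_sumr.
rewrite -mulr_sumr exchange_big /= ler_pdivrMl ?ltr0n //.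
apply: le_trans (ler_sum _ (fun w _ => key w)) _.
by rewrite sumr_const card_ord [X in _ <= X]mulr_natl.
Qed.

(** The errors of all receivers and the mean cost [g] are averaged in one sum, so a single codebook
    is good for all of them at once; [g] will be the leakage divided by the length. *)
Lemma random_coding (K N : nat) (V s : 'I_K -> U -> B -> R) (g : U -> R) (T : R) :
  (0 < N)%N ->
  (forall i u b, 0 <= V i u b) -> (forall i u, \sum_b V i u b = 1) ->
  (forall i u b, 0 <= s i u b) -> (forall i b, \sum_u PU u * s i u b <= 1) -> 0 < T ->
  exists (c : 'I_N -> U) (dec : 'I_K -> B -> 'I_N),
    (forall w, 0 < PU (c w)) /\
    \sum_i (N%:R^-1 * \sum_w \sum_b (dec i b != w)%:R * V i (c w) b) +
      N%:R^-1 * \sum_w g (c w) <=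
    \sum_i (\sum_u \sum_b PU u * V i u b * (s i u b <= T)%R%:R + N.-1%:R / T) +
      \sum_u PU u * g u.
Proof.
move=> N0 V0 V1 s0 s1 T0.
pose w0 := Ordinal N0.
have [|||c [Pc le]] := @exists_le_mean R {ffun 'I_N -> U} (fun c => \prod_w PU (c w))
  (fun c => \sum_i (N%:R^-1 * \sum_w \sum_b
      (threshold_dec w0 (s i) T c b != w)%:R * V i (c w) b) +
      N%:R^-1 * \sum_w g (c w))
  (\sum_i (\sum_u \sum_b PU u * V i u b * (s i u b <= T)%R%:R + N.-1%:R / T) +
      \sum_u PU u * g u).
- by move=> c; apply: prodr_ge0.
- exact: (sum_prod1 (fun=> PU1)).
- under eq_bigr => c _ do rewrite mulrDr mulr_sumr.
  rewrite big_split /= lerD //.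
    rewrite exchange_big /=; apply: ler_sum => i _.
    exact: random_coding_err.
  under eq_bigr => c _ do rewrite mulrCA mulr_sumr.
  rewrite -mulr_sumr exchange_big /=.
  under eq_bigr => w _ do rewrite (expect_coord (fun=> PU1)).
  by rewrite sumr_const card_ord -[X in _ * X]mulr_natl mulKf // pnatr_eq0 -lt0n.
- exists c, (fun i => threshold_dec w0 (s i) T c); split => // w.
  move: Pc; rewrite lt_def => /andP[/prodf_neq0 h _].
  by rewrite lt_def PU0 h.
Qed.

End RandomCoding.

(** * Output law of a randomly drawn codebook *)

Section SoftCovering.
Variables (R : realType) (A B L : finType) (P : A -> R) (V : A -> B -> R).
Variables (om : L -> R) (th : R).
Hypotheses (P0 : forall a, 0 <= P a) (P1 : \sum_a P a = 1).
Hypotheses (V0 : forall a b, 0 <= V a b) (V1 : forall a, \sum_b V a b = 1).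
Hypotheses (om0 : forall l, 0 <= om l) (om1 : \sum_l om l = 1).
Hypothesis omth : forall l, om l <= th.

Definition outlaw (b : B) : R := \sum_a P a * V a b.

Definition mixlaw (u : {ffun L -> A}) (b : B) : R := \sum_l om l * V (u l) b.

Lemma outlaw_ge0 b : 0 <= outlaw b.
Proof. by apply: sumr_ge0 => a _; rewrite mulr_ge0. Qed.

Lemma outlaw_sum1 : \sum_b outlaw b = 1.
Proof.
rewrite exchange_big -P1; apply: eq_bigr => a _.
by rewrite -mulr_sumr V1 mulr1.
Qed.

Lemma outlaw_gt0 a b : 0 < P a -> 0 < V a b -> 0 < outlaw b.
Proof.
move=> Pa Vab; rewrite /outlaw (bigD1 a) //= ltr_pwDl ?mulr_gt0 //.
by apply: sumr_ge0 => ? _; rewrite mulr_ge0.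
Qed.

Lemma mixlaw_ge0 u b : 0 <= mixlaw u b.
Proof. by apply: sumr_ge0 => l _; rewrite mulr_ge0. Qed.

Lemma mixlaw_sum1 u : \sum_b mixlaw u b = 1.
Proof.
rewrite exchange_big -om1; apply: eq_bigr => a _.
by rewrite -mulr_sumr V1 mulr1.
Qed.

Lemma expect_mixlaw b :
  \sum_(u : {ffun L -> A}) (\prod_l P (u l)) * mixlaw u b = outlaw b.
Proof.
under eq_bigr => u _ do rewrite mulr_sumr.
rewrite exchange_big /=.
under eq_bigr => l _ do under eq_bigr => u _ do rewrite mulrCA.
under eq_bigr => l _ do rewrite -mulr_sumr (expect_coord (fun=> P1) l (fun a => V a b)).
by rewrite -mulr_suml om1 mul1r.
Qed.

Lemma th_ge0 : 0 <= th.
Proof.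
case: (pickP L) => [l _|e]; first exact: le_trans (om0 l) (omth l).
by move: om1; rewrite big1 => [/eqP|l _]; rewrite ?[_ == 1]eq_sym ?oner_eq0 //; have := e l.
Qed.

Let bet a b := 1 + th * V a b / outlaw b.

Let bet_ge1 a b : 1 <= bet a b.
Proof. by rewrite lerDl divr_ge0 ?mulr_ge0 ?outlaw_ge0 ?th_ge0. Qed.

Let bet_gt0 a b : 0 < bet a b.
Proof. exact: lt_le_trans ltr01 (bet_ge1 a b). Qed.

(* The conditional mean of [mixlaw u b / outlaw b] given the selected word [u l] is at
   most [bet (u l) b]: the selected word contributes [om l * V / outlaw], and the other,
   independent, words contribute at most [1]. *)
Let mixlaw_ratio_mean b l :
  \sum_(u : {ffun L -> A}) (\prod_l P (u l)) *
     (V (u l) b * (mixlaw u b / (outlaw b * bet (u l) b))) <= outlaw b.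
Proof.
pose G a := V a b / (outlaw b * bet a b).
have G0 a : 0 <= G a by rewrite divr_ge0 // mulr_ge0 ?outlaw_ge0 ?(ltW (bet_gt0 _ _)).
have E : \sum_(u : {ffun L -> A}) (\prod_l P (u l)) *
     (V (u l) b * (mixlaw u b / (outlaw b * bet (u l) b))) =
   \sum_l' om l' * \sum_(u : {ffun L -> A}) (\prod_l P (u l)) * (G (u l) * V (u l') b).
  under [RHS]eq_bigr => l' _ do rewrite mulr_sumr.
  rewrite [RHS]exchange_big /=; apply: eq_bigr => u _.
  rewrite [X in _ * X](_ : _ = G (u l) * mixlaw u b); last by rewrite /G; ring.
  by rewrite /mixlaw !mulr_sumr; apply: eq_bigr => l' _; ring.
rewrite E (bigD1 l) //=.
rewrite (expect_coord (fun=> P1) l (fun a => G a * V a b)).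
apply: (@le_trans _ _ (th * (\sum_a P a * (G a * V a b)) +
    outlaw b * \sum_a P a * G a)).
  rewrite lerD //.
    apply: ler_wpM2r (omth l); apply: sumr_ge0 => a _.
    by apply: mulr_ge0 => //; apply: mulr_ge0.
  apply: (@le_trans _ _ (\sum_(l' | l' != l) om l' * (outlaw b * \sum_a P a * G a))).
    apply: ler_sum => l' l'l; rewrite ler_wpM2l //.
    by rewrite (expect_coord2 (fun=> P1) G (fun a => V a b)) 1?eq_sym // mulrC.
  rewrite -mulr_suml -[X in _ <= X]mul1r ler_wpM2r //.
    by rewrite mulr_ge0 ?outlaw_ge0 // sumr_ge0 // => a _; rewrite mulr_ge0.
  by rewrite -om1 [X in _ <= X](bigD1 l) //= lerDr.
rewrite !mulr_sumr -big_split /= /outlaw; apply: ler_sum => a _.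
rewrite -/(outlaw b).
have [Q0|Q0] := eqVneq (outlaw b) 0.
  by rewrite /G Q0 !(mul0r, invr0, mulr0, addr0) mulr_ge0.
rewrite [X in X <= _](_ : _ = P a * V a b * ((th * V a b / outlaw b + 1) / bet a b)).
  by rewrite [X in X / _](_ : _ = bet a b) ?divff ?mulr1 ?gt_eqF // addrC.
by rewrite /G; field; rewrite Q0 gt_eqF.
Qed.

(** Jensen's inequality, given the selected word and the output, in the form of Gibbs' inequality:
    under the joint law [p] of codebook, output and selected index, the difference of the two sides
    is the mean of [ln r], and [mixlaw_ratio_mean] says that [r] has mean at most 1. *)
Lemma soft_covering :
  \sum_(u : {ffun L -> A}) (\prod_l P (u l)) *
     \sum_b mixlaw u b * ln (mixlaw u b / outlaw b) <=
  \sum_a \sum_b P a * V a b * ln (1 + th * V a b / outlaw b).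
Proof.
rewrite -subr_le0.
pose p (t : {ffun L -> A} * B * L) :=
  (\prod_l P (t.1.1 l)) * om t.2 * V (t.1.1 t.2) t.1.2.
pose r (t : {ffun L -> A} * B * L) :=
  mixlaw t.1.1 t.1.2 / (outlaw t.1.2 * bet (t.1.1 t.2) t.1.2).
have PL0 (u : {ffun L -> A}) : 0 <= \prod_l P (u l) by apply: prodr_ge0.
have p0 t : 0 <= p t by rewrite !mulr_ge0.
have tri (F : {ffun L -> A} * B * L -> R) :
    \sum_t F t = \sum_u \sum_b \sum_l F (u, b, l).
  rewrite (pair_big predT predT (fun u b => \sum_l F (u, b, l))) /=.
  rewrite (pair_big predT predT (fun ub l => F (ub.1, ub.2, l))) /=.
  by apply: eq_bigr => -[[]].
have pos t : 0 < p t -> [/\ 0 < mixlaw t.1.1 t.1.2 & 0 < outlaw t.1.2].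
  case: t => [[u b] l]; rewrite /p /= => pt.
  have [PL oml Vl] : [/\ (forall l, P (u l) != 0), om l != 0 & V (u l) b != 0].
    move: pt; rewrite lt_def !mulf_eq0 !negb_or => /andP[/andP[/andP[/prodf_neq0 PL ? ?]] _].
    by split => // l'; apply: PL.
  have Vl0 : 0 < V (u l) b by rewrite lt_def Vl V0.
  split; last by apply: (@outlaw_gt0 (u l)) => //; rewrite lt_def PL ?P0.
  rewrite /mixlaw (bigD1 l) //= ltr_pwDl ?mulr_gt0 ?sumr_ge0 //; last by move=> *; rewrite mulr_ge0.
  by rewrite lt_def oml om0.
have le := @sum_ln_le0 R _ p r p0.
apply: le_trans (le _ _).
- rewrite tri.
  have -> : \sum_a \sum_b P a * V a b * ln (1 + th * V a b / outlaw b) =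
    \sum_(u : {ffun L -> A}) (\prod_l P (u l)) * \sum_b \sum_l om l * V (u l) b * ln (bet (u l) b).
    transitivity (\sum_l om l * \sum_a P a * (\sum_b V a b * ln (bet a b))).
      rewrite -mulr_suml om1 mul1r; apply: eq_bigr => a _.
      by rewrite mulr_sumr; apply: eq_bigr => b _; rewrite mulrA.
    under eq_bigr => l _ do
      rewrite -(expect_coord (fun=> P1) l (fun a => \sum_b V a b * ln (bet a b))) mulr_sumr.
    rewrite exchange_big; apply: eq_bigr => u _ /=.
    rewrite exchange_big mulr_sumr; apply: eq_bigr => l _ /=.
    rewrite mulrCA mulr_sumr; congr (_ * _); apply: eq_bigr => b _; ring.
  rewrite -sumrB; apply: ler_sum => u _; rewrite -mulrBr -sumrB mulr_sumr.
  apply: ler_sum => b _; rewrite {1}/mixlaw mulr_suml -sumrB mulr_sumr.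
  apply: ler_sum => l _.
  have [p00|pn0] := eqVneq (p (u, b, l)) 0.
    rewrite p00 mul0r -mulrBr !mulrA.
    by move: p00; rewrite /p /= => ->; rewrite mul0r.
  have /pos[/= m0 q0] : 0 < p (u, b, l) by rewrite lt_def pn0 p0.
  rewrite -mulrBr !mulrA /p /r /=.
  by rewrite invfM mulrA (ln_div (x := mixlaw u b / outlaw b)) ?posrE ?divr_gt0.
- by move=> t /pos[m0 q0]; rewrite /r divr_gt0 ?mulr_gt0.
- rewrite !tri exchange_big [X in _ <= X]exchange_big; apply: ler_sum => b _ /=.
  rewrite exchange_big [X in _ <= X]exchange_big; apply: ler_sum => l _ /=.
  rewrite /p /r /=.
  apply: (@le_trans _ _ (om l * outlaw b)).
    apply: le_trans (ler_wpM2l (om0 l) (mixlaw_ratio_mean b l)).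
    rewrite mulr_sumr; apply: ler_sum => u _.
    by rewrite le_eqVlt; apply/orP; left; apply/eqP; ring.
  rewrite -[outlaw b](expect_coord (fun=> P1) l (fun a => V a b)) mulr_sumr.
  by apply: ler_sum => u _; rewrite mulrCA mulrA.
Qed.

End SoftCovering.

(** * Degradedness and conditional mutual information *)

Section SingleLetter.
Variables (R : realType).

Lemma sum_gt0_term (I : finType) (F : I -> R) (i : I) :
  (forall j, 0 <= F j) -> 0 < F i -> 0 < \sum_j F j.
Proof. by move=> F0 Fi; rewrite (bigD1 i) //= ltr_pwDl // sumr_ge0. Qed.

(** In nats, whereas [condMI] is in bits. *)
Definition mutual_info (X B : finType) (p : X -> R) (V : X -> B -> R) : R :=
  \sum_x \sum_b p x * V x b * ln (V x b / outlaw p V b).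

Variables (X A B : finType) (p : X -> R) (V : X -> A -> B -> R).
Hypotheses (p0 : forall x, 0 <= p x) (V0 : forall x a b, 0 <= V x a b).

Definition fst_law (x : X) (a : A) : R := \sum_b V x a b.
Definition snd_law (x : X) (b : B) : R := \sum_a V x a b.
Definition pair_out (a : A) (b : B) : R := \sum_x p x * V x a b.

Lemma pair_out_sum b : \sum_a pair_out a b = outlaw p snd_law b.
Proof.
rewrite exchange_big; apply: eq_bigr => x _.
by rewrite -mulr_sumr.
Qed.

Lemma joint_support x a b : p x * V x a b != 0 ->
  [/\ 0 < p x, 0 < V x a b, 0 < fst_law x a & 0 < snd_law x b] /\
  [/\ 0 < pair_out a b, 0 < outlaw p fst_law a & 0 < outlaw p snd_law b].
Proof.
rewrite mulf_eq0 negb_or => /andP[px Vx].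
have px0 : 0 < p x by rewrite lt_def px p0.
have Vx0 : 0 < V x a b by rewrite lt_def Vx V0.
have f0 : 0 < fst_law x a by apply: (sum_gt0_term (i := b)).
have s0 : 0 < snd_law x b by apply: (sum_gt0_term (i := a)).
do !split => //; apply: (sum_gt0_term (i := x)); rewrite ?mulr_gt0 // => j;
  by rewrite mulr_ge0 // sumr_ge0.
Qed.

Lemma condMI_ln :
  condMI (fun x a b => p x * V x a b) * ln 2 =
  \sum_x \sum_a \sum_b p x * V x a b *
    ln ((V x a b * outlaw p snd_law b) / (snd_law x b * pair_out a b)).
Proof.
rewrite /condMI mulr_suml; apply: eq_bigr => x _.
rewrite mulr_suml; apply: eq_bigr => a _.
rewrite mulr_suml; apply: eq_bigr => b _.
case: eqP => [->|/eqP nz]; first by rewrite !mul0r.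
have [[px Vx _ s0] [po _ so]] := joint_support nz.
rewrite /log2 -[LHS]mulrA divfK ?gt_eqF ?ln2_gt0 //; congr (_ * ln _).
have -> : \sum_a' \sum_b' p a' * V a' b' b = outlaw p snd_law b.
  by apply: eq_bigr => x' _; rewrite -mulr_sumr.
rewrite -mulr_sumr -/(snd_law x b) -/(pair_out a b).
by field; rewrite !gt_eqF.
Qed.

(** Linear in [p], plus terms [t * ln t] at linear functions of [p]: in this form continuity extends
    to laws with zero entries, where the ratios in [condMI] degenerate. *)
Lemma condMI_split :
  condMI (fun x a b => p x * V x a b) * ln 2 =
  (\sum_x p x * \sum_a \sum_b V x a b * ln (V x a b / snd_law x b)) +
  \sum_b outlaw p snd_law b * ln (outlaw p snd_law b) -
  \sum_a \sum_b pair_out a b * ln (pair_out a b).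
Proof.
rewrite condMI_ln.
have -> : \sum_b outlaw p snd_law b * ln (outlaw p snd_law b) =
    \sum_x \sum_a \sum_b p x * V x a b * ln (outlaw p snd_law b).
  rewrite [RHS]exchange_big /=.
  under [RHS]eq_bigr => a _ do rewrite exchange_big /=.
  rewrite [RHS]exchange_big /=; apply: eq_bigr => b _.
  rewrite -{1}pair_out_sum mulr_suml; apply: eq_bigr => a _.
  by rewrite mulr_suml.
have -> : \sum_a \sum_b pair_out a b * ln (pair_out a b) =
    \sum_x \sum_a \sum_b p x * V x a b * ln (pair_out a b).
  rewrite [RHS]exchange_big /=; apply: eq_bigr => a _.
  rewrite exchange_big /=; apply: eq_bigr => b _.
  by rewrite mulr_suml.
rewrite -big_split -sumrB /=; apply: eq_bigr => x _.
rewrite mulr_sumr -big_split -sumrB /=; apply: eq_bigr => a _.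
rewrite mulr_sumr -big_split -sumrB /=; apply: eq_bigr => b _.
have [z|nz] := eqVneq (p x * V x a b) 0.
  by rewrite mulrA z !mul0r addr0 subr0.
have [[px Vx _ s0] [po _ so]] := joint_support nz.
rewrite mulrA -mulrDr -mulrBr; congr (_ * _).
rewrite -!(lnM, ln_div) ?posrE ?mulr_gt0 ?divr_gt0 ?invr_gt0 //.
by congr ln; field; rewrite !gt_eqF.
Qed.

(** The hypothesis is the Markov chain from [x] through [a] to [b], cross-multiplied to avoid
    division. It replaces [V x a b / pair_out a b] by [fst_law x a / outlaw p fst_law a], and the
    logarithm splits. *)
Lemma condMI_degraded_snd :
  (forall x x' a b, V x a b * fst_law x' a = fst_law x a * V x' a b) ->
  condMI (fun x a b => p x * V x a b) * ln 2 =
  mutual_info p fst_law - mutual_info p snd_law.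
Proof.
move=> mk.
have mk' x a b : V x a b * outlaw p fst_law a = fst_law x a * pair_out a b.
  rewrite !mulr_sumr; apply: eq_bigr => x' _.
  by rewrite mulrCA mk mulrCA.
rewrite condMI_ln -sumrB; apply: eq_bigr => x _.
have -> : \sum_a p x * fst_law x a * ln (fst_law x a / outlaw p fst_law a) =
    \sum_a \sum_b p x * V x a b * ln (fst_law x a / outlaw p fst_law a).
  by apply: eq_bigr => a _; rewrite -mulr_suml -mulr_sumr.
have -> : \sum_b p x * snd_law x b * ln (snd_law x b / outlaw p snd_law b) =
    \sum_a \sum_b p x * V x a b * ln (snd_law x b / outlaw p snd_law b).
  by rewrite exchange_big; apply: eq_bigr => b _; rewrite -mulr_suml -mulr_sumr.
rewrite -sumrB; apply: eq_bigr => a _.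
rewrite -sumrB; apply: eq_bigr => b _.
have [->|nz] := eqVneq (p x * V x a b) 0; first by rewrite !mul0r subr0.
have [[px Vx f0 s0] [po fo so]] := joint_support nz.
rewrite -mulrBr -ln_div ?posrE ?divr_gt0 //; congr (_ * ln _).
have -> : V x a b = fst_law x a * pair_out a b / outlaw p fst_law a.
  by rewrite -mk' mulfK // gt_eqF.
by field; rewrite !gt_eqF.
Qed.

(** In the order [x], [b], [a], the output [a] says nothing more about [x] once [b] is known: on the
    support, the argument of each logarithm is 1. *)
Lemma condMI_degraded_fst :
  (forall x x' a b, V x a b * snd_law x' b = snd_law x b * V x' a b) ->
  condMI (fun x a b => p x * V x a b) = 0.
Proof.
move=> mk.
have mk' x a b : V x a b * outlaw p snd_law b = snd_law x b * pair_out a b.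
  rewrite !mulr_sumr; apply: eq_bigr => x' _.
  by rewrite mulrCA mk mulrCA.
apply: (mulIf (lt0r_neq0 (ln2_gt0 R))).
rewrite condMI_ln mul0r big1 // => x _; rewrite big1 // => a _; rewrite big1 // => b _.
have [->|nz] := eqVneq (p x * V x a b) 0; first by rewrite !mul0r.
have [[px Vx f0 s0] [po fo so]] := joint_support nz.
by rewrite mk' divff ?ln1 ?mulr0 // gt_eqF ?mulr_gt0.
Qed.

End SingleLetter.

(** * The Markov property of degraded outputs *)

Section Degraded.
Variables (R : realType) (X Y : finType) (K M : nat).
Implicit Types W : channel R X Y K M.

Definition out_marg W (j : 'I_M) (k : 'I_K.+1) (x : X) (b : Y) : R :=
  \sum_(y : outsym Y K | y k == b) W j x y.

Definition pair_marg W (j : 'I_M) (i : 'I_K) (x : X) (a b : Y) : R :=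
  \sum_(y : outsym Y K | (y (rcv i) == a) && (y (eve K) == b)) W j x y.

Lemma pair_marg_fst W j i x a : fst_law (pair_marg W j i) x a = out_marg W j (rcv i) x a.
Proof.
rewrite /fst_law /out_marg (partition_big (fun y : outsym Y K => y (eve K)) predT) //=.
Qed.

Lemma pair_marg_snd W j i x b : snd_law (pair_marg W j i) x b = out_marg W j (eve K) x b.
Proof.
rewrite /snd_law /out_marg (partition_big (fun y : outsym Y K => y (rcv i)) predT) //=.
by apply: eq_bigr => a _; apply: eq_bigl => y; rewrite andbC.
Qed.

(* Exchanging the tails (positions after that of [m]) of two outputs that agree at [m]
   preserves the product of their probabilities: this is the Markov property. *)
Lemma degraded_markov (F : X -> outsym Y K -> R) (pi : {perm 'I_K.+1})
    (q : 'I_K -> Y -> {ffun Y -> R}) (m l : 'I_K.+1) :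
  (forall x y, F x y =
     (\sum_(y' : outsym Y K | y' (pi ord0) == y (pi ord0)) F x y') *
     \prod_(k < K) q k (y (pi (inord k))) (y (pi (inord k.+1)))) ->
  (pi^-1%g m < pi^-1%g l)%N ->
  forall x x' a b,
  (\sum_(y : outsym Y K | (y m == a) && (y l == b)) F x y) *
    (\sum_(y : outsym Y K | y m == a) F x' y) =
  (\sum_(y : outsym Y K | y m == a) F x y) *
    (\sum_(y : outsym Y K | (y m == a) && (y l == b)) F x' y).
Proof.
move=> FE ml x x' a b.
pose early (k : 'I_K.+1) := (pi^-1%g k <= pi^-1%g m)%N.
pose mix (y y' : outsym Y K) : outsym Y K := [ffun k => if early k then y k else y' k].
have earlyE k : early (pi k) = (k <= pi^-1%g m)%N by rewrite /early permK.
have swapF (y y' : outsym Y K) : y m == y' m -> F x y * F x' y' = F x (mix y y') * F x' (mix y' y).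
  move=> /eqP ymy'; rewrite !FE.
  have e0 : early (pi ord0) by rewrite earlyE.
  rewrite [in LHS]mulrACA [in RHS]mulrACA !ffunE e0; congr (_ * _).
  rewrite -!big_split /=; apply: eq_bigr => k _; rewrite !ffunE !earlyE.
  have k1 : (k < K.+1)%N by rewrite ltnS ltnW.
  rewrite !inordK ?ltnS //.
  (* Kernel [k] joins the positions [k] and [k.+1]. Both are early, or both are late, or [k] is the
     position of [m], where [y] and [y'] agree. *)
  have [lt|] := ltnP k (pi^-1%g m); first by rewrite (ltnW lt).
  rewrite leq_eqVlt => /orP[/eqP e|gt]; last by rewrite leqNgt gt /= mulrC.
  rewrite -e leqnn.
  have -> : pi (inord (pi^-1%g m)) = m by rewrite inord_val permKV.
  by rewrite ymy' mulrC.
rewrite !big_distrlr /= !pair_big /=.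
pose swap (yy : outsym Y K * outsym Y K) := (mix yy.1 yy.2, mix yy.2 yy.1).
rewrite (reindex swap) /=; last first.
  have inv : involutive swap.
    by move=> [y y'] /=; congr pair; apply/ffunP => k; rewrite !ffunE; case: (early k).
  by exists swap => yy _; apply: inv.
have em : early m by rewrite /early leqnn.
have el : early l = false by rewrite /early leqNgt ml.
apply: eq_big => [[y y']|[y y']] /=; rewrite !ffunE em el; first by rewrite andbAC andbA.
by move=> /andP[/andP[/eqP h1 _] /eqP h2]; rewrite -swapF // h1 h2.
Qed.

Lemma pair_marg_ge0 W j i x a b : is_channel W -> 0 <= pair_marg W j i x a b.
Proof. by move=> hW; apply: sumr_ge0 => y _; case: (hW j x). Qed.

Lemma out_marg_ge0 W j k x b : is_channel W -> 0 <= out_marg W j k x b.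
Proof. by move=> hW; apply: sumr_ge0 => y _; case: (hW j x). Qed.

Lemma out_marg_sum1 W j k x : is_channel W -> \sum_b out_marg W j k x b = 1.
Proof.
move=> hW; case: (hW j x) => _ <-.
by rewrite [RHS](partition_big (fun y : outsym Y K => y k) predT).
Qed.

(** The alternatives come from the two relative positions of receiver [i] and the eavesdropper in
    the order of channel [j]. *)
Lemma condMI_rev_degraded W (j : 'I_M) (i : 'I_K) (p : {ffun X -> R}) :
  is_channel W -> rev_degraded W -> is_pmf p ->
  condMI (joint_xyz W j p i) = 0 \/
  condMI (joint_xyz W j p i) * ln 2 =
    mutual_info p (out_marg W j (rcv i)) - mutual_info p (out_marg W j (eve K)).
Proof.
move=> hW hD [p0 _].
have V0 x a b := pair_marg_ge0 j i x a b hW.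
have [pi [q [_ FE]]] := hD j.
have [lt|] := ltnP (pi^-1%g (rcv i)) (pi^-1%g (eve K)).
  right; rewrite (condMI_degraded_snd p0 V0) => [|x x' a b].
    by congr (_ - _); apply: eq_bigr => x _; apply: eq_bigr => b _;
      rewrite /outlaw ?pair_marg_fst ?pair_marg_snd;
      under eq_bigr => ? _ do rewrite ?pair_marg_fst ?pair_marg_snd.
  rewrite !pair_marg_fst; exact: degraded_markov FE lt _ _ _ _.
(* Equal positions would identify the eavesdropper, of index [K], with a receiver of index below
   [K]. *)
rewrite leq_eqVlt => /orP[/eqP/val_inj/perm_inj/(congr1 val)/= e|lt].
  by have := ltn_ord i; rewrite -e ltnn.
left; apply: (condMI_degraded_fst p0 V0) => x x' a b.
rewrite !pair_marg_snd.
have := degraded_markov FE lt x x' b a.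
by rewrite /pair_marg; under [X in X * _ = _]eq_bigl => y do rewrite andbC;
  under [X in _ = _ * X]eq_bigl => y do rewrite andbC.
Qed.

End Degraded.

(** * Converse *)

Section Words.
Variables (R : realType) (X Y : finType) (K M : nat) (W : channel R X Y K M).
Variable (n : nat).
Hypothesis hW : is_channel W.

(** Any symbolwise view [f] of the output is again memoryless. It serves for one observer and for a
    receiver paired with the eavesdropper. *)
Lemma chan_n_marg (S : finType) (f : outsym Y K -> S)
    (x : inword X M n) (s : {ffun 'I_M -> {ffun 'I_n -> S}}) :
  \sum_(y : outword Y K M n | [ffun j => [ffun t => f (y j t)]] == s) chan_n W x y =
  \prod_j \prod_t \sum_(o | f o == s j t) W j (x j t) o.
Proof.
rewrite /chan_n.
under [RHS]eq_bigr => j _ do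
  rewrite -(sum_prod_marginal (fun t => W j (x j t)) (fun _ => f) (s j)).
exact: (sum_prod_marginal
  (fun j (v : {ffun 'I_n -> outsym Y K}) => \prod_t W j (x j t) (v t))
  (fun _ (v : {ffun 'I_n -> outsym Y K}) => [ffun t => f (v t)])).
Qed.

Definition obs_law (k : 'I_K.+1) (x : inword X M n) (z : obsword Y M n) : R :=
  \prod_j \prod_t out_marg W j k (x j t) (z j t).

Definition pair_law (i : 'I_K) (x : inword X M n) (a z : obsword Y M n) : R :=
  \prod_j \prod_t pair_marg W j i (x j t) (a j t) (z j t).

Lemma chan_n_obs k x z :
  \sum_(y : outword Y K M n | observe k y == z) chan_n W x y = obs_law k x z.
Proof. exact: (chan_n_marg (fun o : outsym Y K => o k)). Qed.

Lemma sum_chan_n_obs k x (G : obsword Y M n -> R) :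
  \sum_(y : outword Y K M n) chan_n W x y * G (observe k y) =
  \sum_z obs_law k x z * G z.
Proof.
rewrite (partition_big (fun y : outword Y K M n => observe k y) predT) //=.
apply: eq_bigr => z _; rewrite -chan_n_obs mulr_suml.
by apply: eq_bigr => y /eqP ->.
Qed.

Lemma sum_chan_n_pair i x (G : obsword Y M n -> obsword Y M n -> R) :
  \sum_(y : outword Y K M n) chan_n W x y * G (observe (rcv i) y) (observe (eve K) y) =
  \sum_a \sum_z pair_law i x a z * G a z.
Proof.
rewrite (partition_big
  (fun y : outword Y K M n => (observe (rcv i) y, observe (eve K) y)) predT) //=.
rewrite (pair_big predT predT (fun a z => pair_law i x a z * G a z)) /=.
apply: eq_bigr => -[a z] _ /=.
have -> : pair_law i x a z = \sum_(y : outword Y K M n |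
    (observe (rcv i) y, observe (eve K) y) == (a, z)) chan_n W x y.
  have := chan_n_marg (fun o : outsym Y K => (o (rcv i), o (eve K))) x
    [ffun j => [ffun t => (a j t, z j t)]].
  rewrite (_ : \prod_j _ = pair_law i x a z) => [<-|].
    apply: eq_bigl => y; apply/eqP/eqP => [h|[<- <-]]; last first.
      by apply/ffunP => j; apply/ffunP => t; rewrite !ffunE.
    by congr pair; apply/ffunP => j; apply/ffunP => t;
      move/ffunP/(_ j)/ffunP/(_ t): h; rewrite !ffunE => -[].
  apply: eq_bigr => j _; apply: eq_bigr => t _; apply: eq_bigl => o.
  by rewrite !ffunE.
by rewrite mulr_suml; apply: eq_bigr => y /eqP[-> ->].
Qed.

Lemma pair_law_ge0 i x a z : 0 <= pair_law i x a z.
Proof. by do 2 (apply: prodr_ge0 => ? _); exact: pair_marg_ge0. Qed.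

Lemma pair_law_sum i x z : \sum_a pair_law i x a z = obs_law (eve K) x z.
Proof.
rewrite /pair_law -(bigA_distr_bigA (fun j (v : {ffun 'I_n -> Y}) =>
  \prod_t pair_marg W j i (x j t) (v t) (z j t))) /=.
apply: eq_bigr => j _.
rewrite -(bigA_distr_bigA (fun t b => pair_marg W j i (x j t) b (z j t))).
by apply: eq_bigr => t _; rewrite -(pair_marg_snd W j i).
Qed.

Lemma obs_law_sum1 k x : \sum_z obs_law k x z = 1.
Proof.
rewrite /obs_law -(bigA_distr_bigA (fun j (v : {ffun 'I_n -> Y}) =>
  \prod_t out_marg W j k (x j t) (v t))) /=.
rewrite big1 // => j _; rewrite -(bigA_distr_bigA (fun t => out_marg W j k (x j t))).
by rewrite big1 // => t _; apply: out_marg_sum1.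
Qed.

Lemma pair_marg_sum1 j i x : \sum_a \sum_b pair_marg W j i x a b = 1.
Proof.
by rewrite -[RHS](out_marg_sum1 j (rcv i) x hW); apply: eq_bigr => a _; rewrite -pair_marg_fst.
Qed.

(** The law is a product over channels of products over times, so the coordinate [(j, t)] is
    isolated by two applications of [expect_coord]. *)
Lemma expect_pair_law_coord i x (j : 'I_M) (t : 'I_n) (F : Y -> Y -> R) :
  \sum_a \sum_z pair_law i x a z * F (a j t) (z j t) =
  \sum_a \sum_b pair_marg W j i (x j t) a b * F a b.
Proof.
rewrite sum_ffun_pair /pair_law.
pose p j (v : {ffun 'I_n -> Y} * {ffun 'I_n -> Y}) :=
  \prod_t pair_marg W j i (x j t) (v.1 t) (v.2 t).
pose q j t (b : Y * Y) := pair_marg W j i (x j t) b.1 b.2.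
have q1 j' t' : \sum_b q j' t' b = 1.
  by rewrite -(pair_marg_sum1 j' i (x j' t')) pair_big.
have pE j' (G : {ffun 'I_n -> Y} -> {ffun 'I_n -> Y} -> R) :
    \sum_v p j' v * G v.1 v.2 =
    \sum_(v : {ffun 'I_n -> Y * Y}) (\prod_t q j' t (v t)) *
       G [ffun t => (v t).1] [ffun t => (v t).2].
  rewrite -(pair_big predT predT (fun v1 v2 => p j' (v1, v2) * G v1 v2)) /= sum_ffun_pair.
  apply: eq_bigr => v _; congr (_ * _); apply: eq_bigr => t' _.
  by rewrite !ffunE.
have p1 j' : \sum_v p j' v = 1.
  have := pE j' (fun _ _ => 1).
  under eq_bigr => v _ do rewrite mulr1.
  move=> ->; under eq_bigr => v _ do rewrite mulr1.
  exact: sum_prod1.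
rewrite (pair_big predT predT (fun a b => pair_marg W j i (x j t) a b * F a b)) /=.
have := expect_coord (q1 j) t (fun b => F b.1 b.2); rewrite /q => <-.
transitivity (\sum_v p j v * F (v.1 t) (v.2 t)); last first.
  rewrite (pE j (fun v1 v2 => F (v1 t) (v2 t))).
  by apply: eq_bigr => v _; rewrite !ffunE.
rewrite -(expect_coord p1 j (fun v => F (v.1 t) (v.2 t))).
apply: eq_bigr => v _; rewrite !ffunE; congr (_ * _).
apply: eq_bigr => j' _; apply: eq_bigr => t' _.
by rewrite !ffunE.
Qed.

End Words.

Section Converse.
Variables (R : realType) (X Y : finType) (K M : nat) (W : channel R X Y K M).
Variables (n N : nat) (enc : 'I_N -> {ffun inword X M n -> R}).
Variables (dec : 'I_K -> obsword Y M n -> 'I_N).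
Hypotheses (hW : is_channel W) (n0 : (0 < n)%N) (N0 : (0 < N)%N).
Hypothesis (henc : forall w, is_pmf (enc w)).

(** Law of the symbol sent on channel [j] at a uniformly random time, for a uniform message. *)
Definition avg_input (j : 'I_M) : {ffun X -> R} :=
  [ffun a => n%:R^-1 * \sum_t \sum_w \sum_(x : inword X M n | x j t == a) N%:R^-1 * enc w x].

Let Ngt0 : 0 < N%:R :> R. Proof. by rewrite ltr0n. Qed.
Let ngt0 : 0 < n%:R :> R. Proof. by rewrite ltr0n. Qed.
Let enc0 w x : 0 <= enc w x. Proof. by case: (henc w). Qed.
Let enc1 w : \sum_x enc w x = 1. Proof. by case: (henc w). Qed.

Lemma sum_msg (c : R) : \sum_(w < N) N%:R^-1 * c = c.
Proof. by rewrite sumr_const card_ord -[X in X = _]mulr_natl mulVKf // gt_eqF. Qed.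

Lemma expect_avg_input j (H : X -> R) :
  \sum_w \sum_(x : inword X M n) N%:R^-1 * enc w x * \sum_t H (x j t) =
  n%:R * \sum_a avg_input j a * H a.
Proof.
under [in RHS]eq_bigr => a _ do rewrite ffunE -mulrA.
rewrite -mulr_sumr mulVKf ?gt_eqF //.
under [RHS]eq_bigr => a _ do rewrite mulr_suml.
rewrite [RHS]exchange_big /=.
under eq_bigr => w _ do under eq_bigr => x _ do rewrite mulr_sumr.
under eq_bigr => w _ do rewrite exchange_big /=.
rewrite exchange_big /=; apply: eq_bigr => t _.
under [RHS]eq_bigr => a _ do rewrite mulr_suml.
rewrite [RHS]exchange_big /=; apply: eq_bigr => w _.
rewrite (partition_big (fun x : inword X M n => x j t) predT) //=.
apply: eq_bigr => a _; rewrite mulr_suml.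
by apply: eq_bigr => x /eqP ->.
Qed.

Lemma avg_input_pmf j : is_pmf (avg_input j).
Proof.
split=> [a|].
  rewrite ffunE mulr_ge0 ?invr_ge0 ?ler0n //.
  by do 3 (apply: sumr_ge0 => ? _); rewrite mulr_ge0 ?invr_ge0 ?ler0n.
apply: (mulfI (lt0r_neq0 ngt0)); rewrite mulr1.
have := expect_avg_input j (fun _ => 1).
under [in RHS]eq_bigr => a _ do rewrite mulr1.
move=> <-; rewrite sumr_const card_ord.
under eq_bigr => w _ do rewrite -mulr_suml -mulr_sumr enc1 -mulrA mul1r.
by rewrite sum_msg.
Qed.

Lemma avg_input_gt0 w (x : inword X M n) j t : 0 < enc w x -> 0 < avg_input j (x j t).
Proof.
move=> ewx; rewrite ffunE mulr_gt0 ?invr_gt0 //.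
have T0 w' (x' : inword X M n) : 0 <= N%:R^-1 * enc w' x' by rewrite mulr_ge0 // invr_ge0 ltW.
apply: (sum_gt0_term (i := t)); first by move=> *; do 2 (apply: sumr_ge0 => ? _).
apply: (sum_gt0_term (i := w)); first by move=> *; apply: sumr_ge0.
rewrite (bigD1 x) //= ltr_pwDl ?sumr_ge0 // mulr_gt0 ?invr_gt0 //.
Qed.

Lemma msg_eveE w z : msg_eve W enc w z =
  \sum_(x : inword X M n) N%:R^-1 * enc w x * obs_law W (eve K) x z.
Proof.
apply: eq_bigr => x _; rewrite -chan_n_obs mulr_sumr.
by [].
Qed.

Variable i : 'I_K.

(** Joint law of the message, the input, the output of receiver [i] and the output of the
    eavesdropper. *)
Let jnt w (x : inword X M n) (a z : obsword Y M n) := N%:R^-1 * enc w x * pair_law W i x a z.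

Let jnt0 w x a z : 0 <= jnt w x a z.
Proof. by rewrite !mulr_ge0 ?invr_ge0 ?ler0n // pair_law_ge0. Qed.

Lemma err_probE : err_prob W enc dec i =
  \sum_w \sum_x \sum_a \sum_z jnt w x a z * (dec i a != w)%:R.
Proof.
apply: eq_bigr => w _; apply: eq_bigr => x _.
rewrite -(eq_bigr _ (fun a _ => eq_bigr _ (fun z _ =>
  mulrA (N%:R^-1 * enc w x) (pair_law W i x a z) (dec i a != w)%:R))).
under [RHS]eq_bigr => a _ do rewrite -mulr_sumr.
rewrite -mulr_sumr -(sum_chan_n_pair W i x (fun a _ => (dec i a != w)%:R)) mulr_sumr.
by apply: eq_bigr => y _; case: ifP; rewrite ?mulr1 ?mulr0.
Qed.

Let jnt_sum_a w x z : \sum_a jnt w x a z = N%:R^-1 * enc w x * obs_law W (eve K) x z.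
Proof. by rewrite -mulr_sumr pair_law_sum. Qed.

Let msg_eve_jnt w z : msg_eve W enc w z = \sum_x \sum_a jnt w x a z.
Proof. by rewrite msg_eveE; apply: eq_bigr => x _; rewrite jnt_sum_a. Qed.

Let pz z := \sum_w msg_eve W enc w z.

Lemma msg_eve_ge0 w z : 0 <= msg_eve W enc w z.
Proof. by rewrite msg_eve_jnt; do 2 (apply: sumr_ge0 => ? _). Qed.

Lemma msg_eve_sum1 : \sum_z pz z = 1.
Proof.
rewrite /pz exchange_big /= -[RHS]sum_msg; apply: eq_bigr => w _.
under eq_bigr => z _ do rewrite msg_eveE.
rewrite exchange_big /=.
under eq_bigr => x _ do rewrite -mulr_sumr obs_law_sum1 // mulr1.
by rewrite -mulr_sumr enc1.
Qed.

Let jnt_sum1 : \sum_w \sum_x \sum_a \sum_z jnt w x a z = 1.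
Proof.
rewrite -[RHS]msg_eve_sum1 /pz [RHS]exchange_big /=; apply: eq_bigr => w _.
under [RHS]eq_bigr => z _ do rewrite msg_eve_jnt.
rewrite [RHS]exchange_big; apply: eq_bigr => x _.
by rewrite exchange_big.
Qed.

Let V j := pair_marg W j i.
(** With [q] the joint law induced by [avg_input j], this is [q(a|b) / V(a|x,b)], the inverse of the
    ratio inside the logarithm of [condMI]. *)
Let rho j x a b := snd_law (V j) x b * pair_out (avg_input j) (V j) a b /
   (V j x a b * outlaw (avg_input j) (snd_law (V j)) b).

Let V0 j x a b : 0 <= V j x a b. Proof. exact: pair_marg_ge0. Qed.
Let ai0 j x : 0 <= avg_input j x. Proof. by case: (avg_input_pmf j). Qed.

(** The exponent is a sum over letters, so only single-letter marginals matter, and their average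
    over time is [avg_input]. *)
Let expect_ln_rho :
  \sum_w \sum_x \sum_a \sum_z jnt w x a z *
    (\sum_j \sum_t ln (rho j (x j t) (a j t) (z j t))) =
  - (n%:R * \sum_j condMI (joint_xyz W j (avg_input j) i) * ln 2).
Proof.
transitivity (\sum_j \sum_w \sum_(x : inword X M n) N%:R^-1 * enc w x *
    \sum_t \sum_a \sum_b V j (x j t) a b * ln (rho j (x j t) a b)).
  rewrite [RHS]exchange_big; apply: eq_bigr => w _ /=.
  rewrite [RHS]exchange_big; apply: eq_bigr => x _ /=.
  rewrite -mulr_sumr.
  under eq_bigr => a _ do under eq_bigr => z _ do rewrite -mulrA.
  under eq_bigr => a _ do rewrite -mulr_sumr.
  rewrite -mulr_sumr; congr (_ * _).
  under eq_bigr => a _ do under eq_bigr => z _ do rewrite mulr_sumr.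
  under eq_bigr => a _ do rewrite exchange_big /=.
  rewrite exchange_big /=; apply: eq_bigr => j _.
  under eq_bigr => a _ do under eq_bigr => z _ do rewrite mulr_sumr.
  under eq_bigr => a _ do rewrite exchange_big /=.
  rewrite exchange_big /=; apply: eq_bigr => t _.
  exact: (expect_pair_law_coord hW i x j t (fun a b => ln (rho j (x j t) a b))).
under eq_bigr => j _ do
  rewrite (expect_avg_input j (fun x => \sum_a \sum_b V j x a b * ln (rho j x a b))).
rewrite -mulr_sumr -mulrN; congr (_ * _); rewrite -sumrN; apply: eq_bigr => j _.
rewrite (condMI_ln (ai0 j) (V0 j)) -sumrN; apply: eq_bigr => x _.
rewrite mulr_sumr -sumrN; apply: eq_bigr => a _.
rewrite mulr_sumr -sumrN; apply: eq_bigr => b _.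
rewrite mulrA -mulrN.
have [->|nz] := eqVneq (avg_input j x * V j x a b) 0; first by rewrite !mul0r.
have [[px Vx f0 s0] [po fo so]] := joint_support (ai0 j) (V0 j) nz.
rewrite -lnV ?posrE ?divr_gt0 ?mulr_gt0 //; congr (_ * ln _).
by rewrite invf_div.
Qed.

Variables (del : R).
Hypothesis (hdel : 0 < del < 1).

(** Fano's guess of the message from the decoded one: mass [1 - del] on it, and [del / N%:R] on each
    other message. It costs [- ln (1 - del)] when decoding is right and [ln N%:R - ln del] when it
    is wrong. *)
Let f (w : 'I_N) a := if dec i a == w then 1 - del else del / N%:R.

Let f0 w a : 0 < f w a.
Proof. by case/andP: hdel => d0 d1; rewrite /f; case: ifP; rewrite ?subr_gt0 ?divr_gt0. Qed.

Let f_sum a : \sum_w f w a <= 1.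
Proof.
case/andP: hdel => d0 d1.
apply: (@le_trans _ _ (\sum_w (N%:R^-1 * del + (if w == dec i a then 1 - del else 0)))).
  apply: ler_sum => w _; rewrite /f eq_sym; case: ifP => _; last by rewrite addr0 mulrC.
  by rewrite lerDr mulr_ge0 ?invr_ge0 ?ltW.
by rewrite big_split /= sum_msg -big_mkcond big_pred1_eq addrC subrK.
Qed.

Let rr w (x : inword X M n) (a z : obsword Y M n) :=
  f w a * (\prod_j \prod_t rho j (x j t) (a j t) (z j t)) *
   (pz z / msg_eve W enc w z).

Let jnt_pos w x a z : jnt w x a z != 0 ->
  [/\ 0 < msg_eve W enc w z, 0 < pz z &
      forall j t, 0 < rho j (x j t) (a j t) (z j t)].
Proof.
move=> nz.
have m0 : 0 < msg_eve W enc w z.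
  rewrite msg_eve_jnt; apply: (sum_gt0_term (i := x)); first by move=> ?; apply: sumr_ge0.
  by apply: (sum_gt0_term (i := a)) => //; rewrite lt_def nz jnt0.
split=> // [|j t].
  by apply: (sum_gt0_term (i := w)) => // w'; apply: msg_eve_ge0.
move: nz; rewrite /jnt !mulf_eq0 !negb_or => /andP[/andP[_ e0]].
move=> /prodf_neq0/(_ j isT)/prodf_neq0/(_ t isT) v0.
have ax : 0 < avg_input j (x j t) by apply: (@avg_input_gt0 w); rewrite lt_def e0 enc0.
have nz : avg_input j (x j t) * V j (x j t) (a j t) (z j t) != 0.
  by rewrite mulf_eq0 negb_or gt_eqF.
have [[px Vx ff0 s0] [po fo so]] := joint_support (ai0 j) (V0 j) nz.
by rewrite divr_gt0 ?mulr_gt0.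
Qed.

Let rho0 j x a b : 0 <= rho j x a b.
Proof.
have s0 y c : 0 <= snd_law (V j) y c by apply: sumr_ge0.
rewrite divr_ge0 ?mulr_ge0 ?outlaw_ge0 //.
by apply: sumr_ge0 => ? _; rewrite mulr_ge0.
Qed.

(** The order of summation matters. Over [x], the eavesdropper's law averages to [msg_eve], which
    cancels; then [f] sums over [w] to at most 1, the conditional law [C] sums over [a] to at most
    1, and [pz] remains. *)
Let mass_rr : \sum_w \sum_x \sum_a \sum_z jnt w x a z * rr w x a z <= 1.
Proof.
have s0 j y c : 0 <= snd_law (V j) y c by apply: sumr_ge0.
have po0 j a b : 0 <= pair_out (avg_input j) (V j) a b.
  by apply: sumr_ge0 => ? _; rewrite mulr_ge0.
have Q0 j b : 0 <= outlaw (avg_input j) (snd_law (V j)) b by rewrite outlaw_ge0.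
pose C (a z : obsword Y M n) := \prod_j \prod_t (pair_out (avg_input j) (V j) (a j t) (z j t) /
       outlaw (avg_input j) (snd_law (V j)) (z j t)).
have C0 a z : 0 <= C a z.
  by do 2 (apply: prodr_ge0 => ? _); rewrite divr_ge0.
have pz0 z : 0 <= pz z by apply: sumr_ge0 => w _; apply: msg_eve_ge0.
(* Only an inequality: a zero of [pair_marg] makes the left side vanish, but not necessarily the
   right side. *)
have step (x : inword X M n) (a z : obsword Y M n) :
    pair_law W i x a z * \prod_j \prod_t rho j (x j t) (a j t) (z j t) <=
    obs_law W (eve K) x z * C a z.
  rewrite /pair_law /obs_law /C -!big_split /=; apply: ler_prod => j _.
  rewrite -!big_split /=; apply/andP; split.
    by apply: prodr_ge0 => t _; rewrite mulr_ge0 // V0.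
  apply: ler_prod => t _; rewrite mulr_ge0 ?V0 //=.
  rewrite -(pair_marg_snd W j i) -/(V j) /rho.
  have [->|vn] := eqVneq (V j (x j t) (a j t) (z j t)) 0.
    by rewrite mul0r mulr_ge0 // divr_ge0.
  rewrite le_eqVlt; apply/orP; left; apply/eqP.
  by rewrite invfM mulrCA [RHS]mulrA; congr (_ * _); rewrite mulrA mulfV // mul1r.
apply: (@le_trans _ _ (\sum_w \sum_a \sum_z f w a * C a z * pz z)).
  apply: ler_sum => w _; rewrite exchange_big; apply: ler_sum => a _ /=.
  rewrite exchange_big; apply: ler_sum => z _ /=.
  apply: (@le_trans _ _ (\sum_(x : inword X M n) N%:R^-1 * enc w x * obs_law W (eve K) x z *
      (f w a * C a z * (pz z / msg_eve W enc w z)))).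
    apply: ler_sum => x _; rewrite /jnt /rr.
    rewrite [X in X <= _](_ : _ = N%:R^-1 * enc w x * f w a * (pz z / msg_eve W enc w z) *
      (pair_law W i x a z * \prod_j \prod_t rho j (x j t) (a j t) (z j t))); last by ring.
    apply: le_trans (ler_wpM2l _ (step x a z)) _; last first.
      by rewrite le_eqVlt; apply/orP; left; apply/eqP; ring.
    rewrite !mulr_ge0 ?invr_ge0 ?(ltW (f0 _ _)) ?msg_eve_ge0 ?ler0n //.
  rewrite -mulr_suml -msg_eveE.
  have [->|mn] := eqVneq (msg_eve W enc w z) 0.
    by rewrite mul0r !mulr_ge0 // ltW.
  by rewrite mulrCA [X in _ * X]mulrC divfK.
rewrite exchange_big /=.
apply: (@le_trans _ _ (\sum_a \sum_z C a z * pz z)).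
  apply: ler_sum => a _; rewrite exchange_big; apply: ler_sum => z _ /=.
  under eq_bigr => w _ do rewrite -mulrA.
  by rewrite -mulr_suml ler_piMl // mulr_ge0.
rewrite exchange_big /= -[X in _ <= X]msg_eve_sum1; apply: ler_sum => z _.
rewrite -mulr_suml ler_piMl //.
rewrite /C -(bigA_distr_bigA (fun j (v : {ffun 'I_n -> Y}) =>
  \prod_t (pair_out (avg_input j) (V j) (v t) (z j t) /
    outlaw (avg_input j) (snd_law (V j)) (z j t)))) /=.
apply: Num.Theory.prodr_ile1 => j _.
rewrite -(bigA_distr_bigA (fun t b => pair_out (avg_input j) (V j) b (z j t) /
   outlaw (avg_input j) (snd_law (V j)) (z j t))) /=.
apply/andP; split.
  by apply: prodr_ge0 => t _; apply: sumr_ge0 => b _; rewrite divr_ge0.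
apply: Num.Theory.prodr_ile1 => t _; rewrite -mulr_suml pair_out_sum divr_ge0 //=.
have [->|nz] := eqVneq (outlaw (avg_input j) (snd_law (V j)) (z j t)) 0.
  by rewrite mul0r ler01.
by rewrite divff.
Qed.

Let condHE : condH (msg_eve W enc) * ln 2 =
  \sum_w \sum_x \sum_a \sum_z jnt w x a z * ln (pz z / msg_eve W enc w z).
Proof.
rewrite /condH mulNr mulr_suml -sumrN; apply: eq_bigr => w _.
rewrite mulr_suml -sumrN.
under [RHS]eq_bigr => x _ do rewrite exchange_big /=.
rewrite [RHS]exchange_big /=; apply: eq_bigr => z _.
under [RHS]eq_bigr => x _ do rewrite -mulr_suml.
rewrite -mulr_suml -msg_eve_jnt.
case: eqP => [->|/eqP mn]; first by rewrite !mul0r oppr0.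
have m0 : 0 < msg_eve W enc w z by rewrite lt_def mn msg_eve_ge0.
have z0 : 0 < pz z by apply: (sum_gt0_term (i := w)) => // w'; apply: msg_eve_ge0.
rewrite /log2 -mulrA divfK ?gt_eqF ?ln2_gt0 // -mulrN -lnV ?posrE ?divr_gt0 //.
by rewrite invf_div.
Qed.

(* One averaged inequality [ln r <= r - 1], with
   [r = f(w|a) * qbar(a|z) * p(z) * W(z|x) / (p(w,z) * W(a,z|x))], gives at once the Fano
   inequality (through [f]), the single-letterization and the concavity in the input law
   (through [qbar], the conditional law induced by the time-averaged inputs). *)
Lemma converse_bound :
  condH (msg_eve W enc) * ln 2 <=
  - ln (1 - del) + err_prob W enc dec i * (ln N%:R - ln del) +
  n%:R * \sum_j condMI (joint_xyz W j (avg_input j) i) * ln 2.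
Proof.
case/andP: hdel => d0 d1.
have quad (F : 'I_N -> inword X M n -> obsword Y M n -> obsword Y M n -> R) :
    \sum_w \sum_x \sum_a \sum_z F w x a z =
    \sum_(t : ('I_N * inword X M n) * (obsword Y M n * obsword Y M n)) F t.1.1 t.1.2 t.2.1 t.2.2.
  under eq_bigr => w _ do under eq_bigr => x _ do rewrite (pair_big predT predT (F w x)) /=.
  rewrite (pair_big predT predT (fun w x => \sum_p F w x p.1 p.2)) /=.
  by rewrite pair_big.
have gibbs : \sum_w \sum_x \sum_a \sum_z jnt w x a z * ln (rr w x a z) <= 0.
  rewrite quad; apply: (sum_ln_le0 (p := fun t => jnt t.1.1 t.1.2 t.2.1 t.2.2)
     (r := fun t => rr t.1.1 t.1.2 t.2.1 t.2.2)) => // [t jt|].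
    have [m0 z0 r0] := jnt_pos (lt0r_neq0 jt).
    by rewrite /rr !mulr_gt0 ?invr_gt0 ?f0 //; do 2 (apply: prodr_gt0 => ? _).
  by have h1 := mass_rr; have h2 := jnt_sum1; rewrite !quad in h1 h2; rewrite h2.
have fano : - \sum_w \sum_x \sum_a \sum_z jnt w x a z * ln (f w a) <=
    - ln (1 - del) + err_prob W enc dec i * (ln N%:R - ln del).
  rewrite err_probE -[X in _ <= X + _]mulr1 -[X in _ <= _ * X + _]jnt_sum1.
  rewrite !quad mulr_sumr mulr_suml -big_split -sumrN /=; apply: ler_sum => t _.
  rewrite [X in _ <= X](_ : _ = jnt t.1.1 t.1.2 t.2.1 t.2.2 *
    (- ln (1 - del) + (dec i t.2.1 != t.1.1)%:R * (ln N%:R - ln del))); last by ring.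
  rewrite -mulrN ler_wpM2l // /f; case: eqP => _ /=; first by rewrite mul0r addr0.
  rewrite mul1r ln_div ?posrE // opprB lerDr oppr_ge0 ln_le0 //.
  by rewrite lerBlDr lerDl ltW.
have split3 : \sum_w \sum_x \sum_a \sum_z jnt w x a z * ln (rr w x a z) =
   (\sum_w \sum_x \sum_a \sum_z jnt w x a z * ln (f w a)) +
   (\sum_w \sum_x \sum_a \sum_z jnt w x a z *
      (\sum_j \sum_t ln (rho j (x j t) (a j t) (z j t)))) +
   condH (msg_eve W enc) * ln 2.
  rewrite condHE !quad -!big_split /=; apply: eq_bigr => t _.
  have [->|nz] := eqVneq (jnt t.1.1 t.1.2 t.2.1 t.2.2) 0; first by rewrite !mul0r !addr0.
  have [m0 z0 r0] := jnt_pos nz.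
  have p0 : 0 < \prod_j \prod_t0 rho j (t.1.2 j t0) (t.2.1 j t0) (t.2.2 j t0).
    by do 2 (apply: prodr_gt0 => ? _).
  rewrite -!mulrDr; congr (_ * _).
  rewrite /rr [LHS]lnM ?posrE; [|by rewrite mulr_gt0 ?f0|by rewrite divr_gt0].
  congr (_ + _); rewrite lnM ?posrE ?f0 //; congr (_ + _).
  rewrite ln_prod => [|j _]; last by apply: prodr_gt0.
  by apply: eq_bigr => j _; rewrite ln_prod.
rewrite split3 expect_ln_rho in gibbs.
lra.
Qed.

End Converse.

(** * Existence of a maximizing input law *)

Section Continuity.
Local Open Scope classical_set_scope.
Variable R : realType.

(** With [s] the square root of [x], the product is [2 * s * (s * ln s)], and [- ln s <= s^-1 - 1]
    bounds [s * ln s] by 1 in absolute value. *)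
Lemma xlnx_bound (x : R) : 0 < x <= 1 -> `|x * ln x| <= 2 * Num.sqrt x.
Proof.
move=> /andP[x0 x1].
have s0 : 0 < Num.sqrt x by rewrite sqrtr_gt0.
have xE : x = Num.sqrt x ^+ 2 by rewrite sqr_sqrtr ?ltW.
have s1 : Num.sqrt x <= 1 by rewrite -sqrtr1 ler_sqrt.
rewrite {1 2}xE lnXn //; set s := Num.sqrt x in s0 s1 *.
have l0 : ln s <= 0 by rewrite ln_le0.
have l1 : - ln s <= s^-1 - 1 by rewrite -lnV ?posrE // ln_le_sub1 ?invr_gt0.
rewrite normrM ger0_norm ?sqr_ge0 // ler0_norm; last by rewrite pmulrn_lle0.
rewrite -mulNrn.
have l2 : s * - ln s <= 1 - s.
  by have := ler_wpM2l (ltW s0) l1; rewrite mulrBr mulr1 divff ?gt_eqF.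
rewrite mulr2n mulrDr expr2 -mulrA; nra.
Qed.

(** Since [ln] is 0 on nonpositive reals, the function vanishes there; to the right of 0 it is
    squeezed by the square root bound. *)
Lemma xlnx_continuous : continuous (fun x : R => x * ln x).
Proof.
move=> x; have [x0|x0|->] := ltgtP x 0.
- have e : \forall y \near x, 0 = y * ln y.
    near=> y; rewrite ln0 ?mulr0 //; apply: ltW; near: y; exact: lt_nbhsl.
  rewrite /continuous_at ln0 ?(ltW x0) // mulr0.
  apply: cvg_trans (@cvg_cst _ 0 _ (nbhs x) _).
  by apply: near_eq_cvg.
- by apply: cvgM; [exact: cvg_id | exact: continuous_ln].
- rewrite /continuous_at mul0r; apply/cvgr0Pnorm_lt => e e0.
  have : 2 * Num.sqrt y @[y --> (0 : R)] --> (0 : R).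
    rewrite -[X in _ --> X](mulr0 2) -[X in _ * X]sqrtr0.
    by apply: cvgM; [exact: cvg_cst | exact: sqrt_continuous].
  move=> /cvgr0Pnorm_lt/(_ _ e0) h.
  near=> y.
  have [y0|y0] := leP y 0; first by rewrite ln0 // mulr0 normr0.
  apply: le_lt_trans (xlnx_bound _) _.
    rewrite y0 /= ltW //; near: y; apply: lt_nbhsl; exact: ltr01.
  by apply: le_lt_trans (ler_norm _) _; near: y.
Unshelve. all: end_near. Qed.

Variable T : topologicalType.

Lemma continuous_sum (I : Type) (r : seq I) (P : pred I) (F : I -> T -> R) :
  (forall i, continuous (F i)) -> continuous (fun v => \sum_(i <- r | P i) F i v).
Proof.
move=> cF; elim: r => [|i r IH] v.
  under eq_fun do rewrite big_nil; exact: cvg_cst.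
under eq_fun do rewrite big_cons.
case: (P i); last exact: IH.
by apply: cvgD; [exact: cF | exact: IH].
Qed.

Lemma continuous_bigmin (I : Type) (r : seq I) (F : I -> T -> R) (f0 : T -> R) :
  continuous f0 -> (forall i, continuous (F i)) ->
  continuous (fun v => \big[Num.min/f0 v]_(i <- r) F i v).
Proof.
move=> c0 cF; elim: r => [|i r IH] v.
  under eq_fun do rewrite big_nil; exact: c0.
under eq_fun do rewrite big_cons.
by apply: (@continuous_min R T (F i)); [exact: cF | exact: IH].
Qed.

End Continuity.

Section MinI.
Variable R : realType.

(** The default value of the fold in [minI] depends on [f]; a fixed index [i0], valid for all [f],
    makes the minimum visibly continuous in the values. *)
Lemma minI_enum (N : nat) (N0 : (0 < N)%N) : exists i0 : 'I_N,
  forall f : 'I_N -> R, minI f = \big[Num.min/f i0]_(i <- enum 'I_N) f i.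
Proof.
exists (Ordinal N0) => f; rewrite /minI big_map.
congr (\big[_/_]_(i <- _) _).
case: N N0 f => // N N0 f; rewrite /image_mem enum_ordSl /=.
by congr f; apply: val_inj.
Qed.

Lemma minI_le (N : nat) (f : 'I_N -> R) (i : 'I_N) : minI f <= f i.
Proof.
have [i0 ->] := minI_enum (leq_ltn_trans (leq0n i) (ltn_ord i)).
by apply: (bigmin_inf_seq (f i0) i) => //; rewrite mem_enum.
Qed.

Lemma le_minI (N : nat) (f : 'I_N -> R) (c : R) : (0 < N)%N ->
  (forall i, c <= f i) -> c <= minI f.
Proof.
move=> N0 h; have [i0 ->] := minI_enum N0.
by elim/big_ind: _ => // x y cx cy; rewrite le_min cx cy.
Qed.

End MinI.

(** * Maximization over a product of simplices *)

Section Maximizer.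
Local Open Scope classical_set_scope.
Variables (R : realType) (X Y : finType) (K M : nat) (W : channel R X Y K M).
Hypotheses (K0 : (0 < K)%N) (X0 : (0 < #|X|)%N) (hW : is_channel W).

(** All input laws together form one point in a product of real lines, so a single use of
    Tychonoff's theorem gives compactness. *)
Let T := prod_topology (fun _ : 'I_M * X => R).
Let lawof (v : T) (j : 'I_M) : {ffun X -> R} := [ffun x => v (j, x)].
Let xlnx (x : R) := x * ln x.

(** The form of [condMI_split], in bits. It makes sense and is continuous on the whole product,
    beyond the families of laws. *)
Let mi (i : 'I_K) (v : T) : R := \sum_j ((\sum_x v (j, x) *
      \sum_a \sum_b pair_marg W j i x a b *
        ln (pair_marg W j i x a b / snd_law (pair_marg W j i) x b)) +
    \sum_b xlnx (\sum_x v (j, x) * snd_law (pair_marg W j i) x b) -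
    \sum_a \sum_b xlnx (\sum_x v (j, x) * pair_marg W j i x a b)) / ln 2.

Let objective_mi (v : T) : (forall j, is_pmf (lawof v j)) ->
  secrecy_objective W (lawof v) = minI (fun i => mi i v).
Proof.
move=> hv; rewrite /secrecy_objective /minI.
suff -> : [seq \sum_(j < M) condMI (joint_xyz W j (lawof v j) i) | i : 'I_K] =
    [seq mi i v | i : 'I_K] by [].
apply: eq_map => i; apply: eq_bigr => j _.
apply: (canRL (mulfK (lt0r_neq0 (ln2_gt0 R)))).
have [p0 _] := hv j.
rewrite (condMI_split p0 (fun x a b => pair_marg_ge0 j i x a b hW)).
congr (_ + _ - _).
- by apply: eq_bigr => x _; rewrite ffunE.
- apply: eq_bigr => b _; rewrite /xlnx /outlaw.
  by under eq_bigr => x _ do rewrite ffunE.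
- apply: eq_bigr => a _; apply: eq_bigr => b _; rewrite /xlnx /pair_out.
  by under eq_bigr => x _ do rewrite ffunE.
Qed.

Let proj_cont (k : 'I_M * X) : continuous (fun v : T => v k).
Proof. exact: (@proj_continuous _ (fun _ : 'I_M * X => R) k). Qed.

Let lin_cont (j : 'I_M) (c : X -> R) : continuous (fun v : T => \sum_x v (j, x) * c x).
Proof.
apply: (@continuous_sum R T X (index_enum X) predT (fun x v => v (j, x) * c x)) => x v.
apply: (@continuousM R T (fun v : T => v (j, x)) (fun=> c x)); first exact: proj_cont.
exact: cst_continuous.
Qed.

Let xlnx_lin_cont (j : 'I_M) (c : X -> R) :
  continuous (fun v : T => xlnx (\sum_x v (j, x) * c x)).
Proof.
move=> v; apply: (continuous_comp (f := fun v : T => \sum_x v (j, x) * c x)).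
  exact: lin_cont.
exact: xlnx_continuous.
Qed.

Let mi_continuous i : continuous (mi i).
Proof.
pose t1 j (v : T) : R := \sum_x v (j, x) *
      \sum_a \sum_b pair_marg W j i x a b *
        ln (pair_marg W j i x a b / snd_law (pair_marg W j i) x b).
pose t2 j (v : T) : R := \sum_b xlnx (\sum_x v (j, x) * snd_law (pair_marg W j i) x b).
pose t3 j (v : T) : R := \sum_a \sum_b xlnx (\sum_x v (j, x) * pair_marg W j i x a b).
have c1 j : continuous (t1 j) by exact: lin_cont.
have c2 j : continuous (t2 j).
  apply: (@continuous_sum R T Y (index_enum Y) predT
    (fun b v => xlnx (\sum_x v (j, x) * snd_law (pair_marg W j i) x b))) => b.
  exact: xlnx_lin_cont.
have c3 j : continuous (t3 j).
  apply: (@continuous_sum R T Y (index_enum Y) predT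
    (fun a v => \sum_b xlnx (\sum_x v (j, x) * pair_marg W j i x a b))) => a.
  apply: (@continuous_sum R T Y (index_enum Y) predT
    (fun b v => xlnx (\sum_x v (j, x) * pair_marg W j i x a b))) => b.
  exact: xlnx_lin_cont.
apply: (@continuous_sum R T 'I_M (index_enum 'I_M) predT
  (fun j v => (t1 j v + t2 j v - t3 j v) / ln 2)) => j v.
apply: (@continuousM R T (fun v => t1 j v + t2 j v - t3 j v) (fun=> (ln 2)^-1));
  last exact: cst_continuous.
apply: (@continuousB R _ T (fun v => t1 j v + t2 j v) (t3 j)); last exact: c3.
by apply: (@continuousD R _ T (t1 j) (t2 j)); [exact: c1 | exact: c2].
Qed.

Let simplices : set T := [set v | forall j, is_pmf (lawof v j)].

Let simplices_compact : compact simplices.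
Proof.
have box : compact [set v : T | forall k, `[0, 1]%classic (v k)].
  apply: (@tychonoff _ (fun _ : 'I_M * X => R) (fun _ => `[0, 1]%classic)) => k.
  exact: segment_compact.
apply: subclosed_compact box _.
  (* The factor 1 makes the total mass an instance of [lin_cont]. *)
  have -> : simplices = \bigcap_j ((\bigcap_x (fun v : T => v (j, x)) @^-1` [set r | 0 <= r]) `&`
      (fun v : T => \sum_x v (j, x) * 1) @^-1` [set r | r = 1]).
    apply/seteqP; split => v.
      move=> h j _; have [h0 h1] := h j; split => [x _ /=|/=].
        by have := h0 x; rewrite ffunE.
      by rewrite -[RHS]h1; apply: eq_bigr => x _; rewrite ffunE mulr1.
    move=> h j; have [/= h0 h1] := h j I; split => [x|].
      by rewrite ffunE; apply: h0.
    by rewrite -[RHS]h1; apply: eq_bigr => x _; rewrite ffunE mulr1.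
  apply: closed_bigI => j _; apply: closedI.
    apply: closed_bigI => x _; apply: preimage_closed; last exact: closed_ge.
    by move=> ? _; exact: proj_cont.
  apply: preimage_closed; last exact: closed_eq.
  by move=> ? _; exact: lin_cont.
move=> v h [j x] /=; have [h0 h1] := h j.
rewrite in_itv /=; have := h0 x; rewrite ffunE => -> /=.
rewrite -h1 (bigD1 x) //= ffunE lerDl sumr_ge0 // => y _; exact: h0.
Qed.

Lemma objective_maximizer : exists pstar : 'I_M -> {ffun X -> R},
    (forall j, is_pmf (pstar j)) /\
    (forall p : 'I_M -> {ffun X -> R}, (forall j, is_pmf (p j)) ->
       secrecy_objective W p <= secrecy_objective W pstar).
Proof.
have lawofE (p : 'I_M -> {ffun X -> R}) : lawof (fun k => p k.1 k.2) = p.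
  by apply/funext => j; apply/ffunP => x; rewrite ffunE.
have [x0 _] : exists x0 : X, x0 \in X by apply/card_gt0P.
pose v0 : T := fun k => (k.2 == x0)%:R.
have ne : simplices !=set0.
  exists v0 => j; split => [x|]; first by rewrite ffunE ler0n.
  rewrite (bigD1 x0) //= ffunE /v0 /= eqxx big1 ?addr0 // => x /negPf xx0.
  by rewrite ffunE /v0 /= xx0.
have [i0 minE] := minI_enum R K0.
have cont : continuous (fun v : T => minI (fun i => mi i v)).
  rewrite (_ : (fun v : T => _) = (fun v : T => \big[Num.min/mi i0 v]_(i <- enum 'I_K) mi i v)).
    by apply: continuous_bigmin => [|i]; exact: mi_continuous.
  by apply/funext => v; rewrite minE.
have [v vS vmax] := compact_EVT_max ne simplices_compact (continuous_subspaceT cont).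
exists (lawof v); have hv := set_mem vS; split=> // p hp.
pose vp : T := fun k => p k.1 k.2.
have hvp : simplices vp by rewrite /simplices /= /vp => j; rewrite lawofE.
rewrite (objective_mi hv) -(lawofE p) (objective_mi hvp).
by apply: vmax; rewrite inE.
Qed.

End Maximizer.

(** * Achievability *)

Section WordChannel.
Variables (R : realType) (X B : finType) (p : X -> R) (V : X -> B -> R) (n : nat).
Hypotheses (p0 : forall x, 0 <= p x) (p1 : \sum_x p x = 1).
Hypotheses (V0 : forall x b, 0 <= V x b) (V1 : forall x, \sum_b V x b = 1).

Definition word_input (a : {ffun 'I_n -> X}) : R := \prod_t p (a t).
Definition word_chan (a : {ffun 'I_n -> X}) (b : {ffun 'I_n -> B}) : R :=
  \prod_t V (a t) (b t).

(** Centered information density of one letter; [info_var] is its variance. *)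
Definition info_dev (x : X) (b : B) : R := ln (V x b / outlaw p V b) - mutual_info p V.
Definition info_var : R := \sum_x \sum_b p x * V x b * info_dev x b ^+ 2.

Lemma mutual_info_ge0 : 0 <= mutual_info p V.
Proof.
rewrite -oppr_le0.
have pos x b : p x * V x b != 0 -> 0 < V x b /\ 0 < outlaw p V b.
  rewrite mulf_eq0 negb_or => /andP[px Vx].
  have Vx0 : 0 < V x b by rewrite lt_def Vx V0.
  by split=> //; apply: (outlaw_gt0 p0 V0 (a := x)) => //; rewrite lt_def px p0.
apply: le_trans (sum_ln_le0 (p := fun xb : X * B => p xb.1 * V xb.1 xb.2)
    (r := fun xb => outlaw p V xb.2 / V xb.1 xb.2) _ _ _).
- rewrite -(pair_big predT predT (fun x b => p x * V x b * ln (outlaw p V b / V x b))) /=.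
  rewrite -sumrN; apply: ler_sum => x _; rewrite -sumrN; apply: ler_sum => b _.
  have [->|/pos[v0 q0]] := eqVneq (p x * V x b) 0; first by rewrite !mul0r oppr0.
  by rewrite -mulrN -lnV ?posrE ?divr_gt0 // invf_div.
- by move=> xb; rewrite mulr_ge0.
- by move=> [x b] /lt0r_neq0/pos[v0 q0]; rewrite divr_gt0.
- rewrite -(pair_big predT predT (fun x b => p x * V x b)) /=.
  rewrite -(pair_big predT predT (fun x b => p x * V x b * (outlaw p V b / V x b))) /=.
  apply: ler_sum => x _; rewrite -mulr_sumr V1 mulr1.
  apply: (@le_trans _ _ (\sum_b p x * outlaw p V b)); last first.
    by rewrite -mulr_sumr outlaw_sum1 // mulr1.
  apply: ler_sum => b _; have [->|v] := eqVneq (V x b) 0.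
    by rewrite mulr0 mul0r mulr_ge0 // outlaw_ge0.
  by rewrite -mulrA [V x b * _]mulrC divfK.
Qed.

Lemma info_var_ge0 : 0 <= info_var.
Proof. by do 2 (apply: sumr_ge0 => ? _); apply: mulr_ge0; [exact: mulr_ge0 | exact: sqr_ge0]. Qed.

Lemma info_dev_mean0 : \sum_x \sum_b p x * V x b * info_dev x b = 0.
Proof.
under eq_bigr => x _ do under eq_bigr => b _ do rewrite mulrBr.
under eq_bigr => x _ do rewrite sumrB -mulr_suml -mulr_sumr V1 mulr1.
by rewrite sumrB -mulr_suml p1 mul1r subrr.
Qed.

Lemma word_input_ge0 a : 0 <= word_input a.
Proof. exact: prodr_ge0. Qed.

Lemma word_input_sum1 : \sum_a word_input a = 1.
Proof. exact: (sum_prod1 (fun=> p1)). Qed.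

Lemma word_chan_ge0 a b : 0 <= word_chan a b.
Proof. exact: prodr_ge0. Qed.

Lemma word_chan_sum1 a : \sum_b word_chan a b = 1.
Proof. exact: (sum_prod1 (p := fun t => V (a t)) (fun t => V1 (a t))). Qed.

Lemma outlaw_word b : outlaw word_input word_chan b = \prod_t outlaw p V (b t).
Proof.
rewrite /outlaw (bigA_distr_bigA (fun t x => p x * V x (b t))).
by apply: eq_bigr => a _; rewrite -big_split.
Qed.

Lemma word_info a b : word_input a * word_chan a b != 0 ->
  [/\ 0 < word_chan a b, 0 < outlaw word_input word_chan b &
  ln (word_chan a b / outlaw word_input word_chan b) =
    n%:R * mutual_info p V + \sum_t info_dev (a t) (b t)].
Proof.
rewrite mulf_eq0 negb_or => /andP[/prodf_neq0 pa /prodf_neq0 va].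
have v0 t : 0 < V (a t) (b t) by rewrite lt_def va ?V0.
have q0 t : 0 < outlaw p V (b t).
  by apply: (outlaw_gt0 p0 V0 (a := a t)) => //; rewrite lt_def pa ?p0.
have vv : 0 < word_chan a b by apply: prodr_gt0.
have qq : 0 < outlaw word_input word_chan b by rewrite outlaw_word; apply: prodr_gt0.
split=> //; rewrite ln_div ?posrE // outlaw_word !ln_prod //.
rewrite [X in _ = _ + X]sumrB sumr_const card_ord mulr_natl addrCA subrr addr0 -sumrB.
by apply: eq_bigr => t _; rewrite ln_div ?posrE.
Qed.

Lemma word_dev_mean0 :
  \sum_a \sum_b word_input a * word_chan a b * \sum_t info_dev (a t) (b t) = 0.
Proof.
under eq_bigr => a _ do under eq_bigr => b _ do rewrite mulr_sumr.
under eq_bigr => a _ do rewrite exchange_big /=.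
rewrite exchange_big /= big1 // => t _.
rewrite (expect_joint_coord (p := fun=> p) (V := fun=> V) (fun=> p1) (fun=> V1) t).
exact: info_dev_mean0.
Qed.

Lemma word_dev_var :
  \sum_a \sum_b word_input a * word_chan a b * (\sum_t info_dev (a t) (b t)) ^+ 2 =
  n%:R * info_var.
Proof.
rewrite (variance_joint (p := fun=> p) (V := fun=> V) (fun=> p1) (fun=> V1)
  (f := fun=> info_dev)) => [|t]; last exact: info_dev_mean0.
by rewrite sumr_const card_ord mulr_natl.
Qed.

Lemma ln_1D_le (s : R) : ln (1 + expR s) <= ln 2 + `|s|.
Proof.
rewrite -[`|s|]expRK -lnM ?posrE ?expR_gt0 // ler_ln ?posrE ?addr_gt0 ?mulr_gt0 ?expR_gt0 //.
rewrite mulr2n mulrDl mul1r lerD ?ler_expR ?ler_norm //.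
by rewrite -[X in X <= _]expR0 ler_expR.
Qed.

(** By the bound on [th], the ratio is at most [expR s], with [s] the total information deviation.
    Now [ln (1 + expR s)] is at most [ln 2 + |s|], and [abs_le_quad] with [c = n%:R * eta] reduces
    [|s|] to the variance [n%:R * info_var]. For small [eta] the bound is a small multiple of [n]
    plus a constant. *)
Lemma covering_rate (th eta : R) : (0 < n)%N -> 0 < eta ->
  0 <= th <= expR (- (n%:R * mutual_info p V)) ->
  \sum_a \sum_b word_input a * word_chan a b *
    ln (1 + th * word_chan a b / outlaw word_input word_chan b) <=
  ln 2 + n%:R * eta + info_var / eta.
Proof.
move=> n0 eta0 /andP[th0 thle].
have ne0 : 0 < n%:R * eta by rewrite mulr_gt0 ?ltr0n.
apply: (@le_trans _ _ (\sum_a \sum_b word_input a * word_chan a b *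
   (ln 2 + n%:R * eta + (\sum_t info_dev (a t) (b t)) ^+ 2 / (n%:R * eta)))).
  apply: ler_sum => a _; apply: ler_sum => b _.
  have [->|nz] := eqVneq (word_input a * word_chan a b) 0; first by rewrite !mul0r.
  have [vv qq lnE] := word_info nz.
  rewrite ler_wpM2l ?mulr_ge0 ?word_input_ge0 ?word_chan_ge0 //.
  set s := \sum_t _ in lnE *.
  apply: le_trans (_ : ln (1 + expR s) <= _).
    have rq : 0 <= th * word_chan a b / outlaw word_input word_chan b.
      by rewrite divr_ge0 ?mulr_ge0 // ltW.
    rewrite ler_ln ?posrE ?lerD2l; [|by rewrite ltr_pwDl|by rewrite addr_gt0 ?expR_gt0].
    rewrite -mulrA -[X in _ * X]lnK ?posrE ?divr_gt0 // lnE expRD mulrA.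
    rewrite ler_piMl ?expR_ge0 //.
    apply: le_trans (ler_wpM2r (expR_ge0 _) thle) _.
    by rewrite -expRD addrC subrr expR0.
  apply: le_trans (ln_1D_le s) _; rewrite -addrA lerD2l.
  exact: abs_le_quad.
under eq_bigr => a _ do under eq_bigr => b _ do rewrite mulrDr mulrA.
under eq_bigr => a _ do rewrite big_split -!mulr_suml -mulr_sumr word_chan_sum1 mulr1.
rewrite big_split /= -!mulr_suml word_input_sum1 mul1r word_dev_var lerD2l.
rewrite invfM mulrACA divff ?mul1r // pnatr_eq0 -lt0n //.
Qed.

End WordChannel.

(** The selection is fixed before the codebook is drawn, so the selected words are again independent
    with the laws [P i]. *)
Lemma pushforward_select (R : realType) (I L A : finType) (P : I -> A -> R)
    (sel : {ffun I -> L}) (Phi : {ffun I -> A} -> R) :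
  (forall i, \sum_a P i a = 1) ->
  \sum_(u : {ffun I -> {ffun L -> A}}) (\prod_i \prod_l P i (u i l)) *
     Phi [ffun i => u i (sel i)] =
  \sum_(x : {ffun I -> A}) (\prod_i P i (x i)) * Phi x.
Proof.
move=> P1.
rewrite (partition_big (fun u : {ffun I -> {ffun L -> A}} => [ffun i => u i (sel i)]) predT) //=.
apply: eq_bigr => x _.
rewrite (eq_bigr (fun u : {ffun I -> {ffun L -> A}} =>
    (\prod_i \prod_l P i (u i l)) * Phi x)); last first.
  by move=> u /eqP ->.
rewrite -mulr_suml; congr (_ * _).
rewrite (sum_prod_marginal (fun i (v : {ffun L -> A}) => \prod_l P i (v l))
   (fun i (v : {ffun L -> A}) => v (sel i))).
apply: eq_bigr => i _; rewrite big_mkcond /=.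
transitivity (\sum_(v : {ffun L -> A}) (\prod_l P i (v l)) * (v (sel i) == x i)%:R).
  by apply: eq_bigr => v _; case: eqP; rewrite ?mulr1 ?mulr0.
rewrite (expect_coord (fun=> P1 i) (sel i) (fun a => (a == x i)%:R)).
rewrite (bigD1 (x i)) //= eqxx mulr1 [X in _ + X]big1 ?addr0 // => a /negPf ->.
by rewrite mulr0.
Qed.

(* The bins of all channels are indexed by one type [L]; [om j] is uniform, with weight
   [th j], on the part of [L] that indexes the bins of channel [j]. *)
Section BinnedCode.
Variables (R : realType) (X Y : finType) (K M n : nat) (W : channel R X Y K M).
Variables (p : 'I_M -> {ffun X -> R}) (L : finType) (om : 'I_M -> L -> R) (th : 'I_M -> R).
Hypotheses (hW : is_channel W) (hp : forall j, is_pmf (p j)) (n0 : (0 < n)%N).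
Hypotheses (om0 : forall j l, 0 <= om j l) (om1 : forall j, \sum_l om j l = 1).
Hypotheses (th0 : forall j, 0 < th j) (omth : forall j l, om j l <= th j).
Hypothesis (thom : forall j l, 0 < om j l -> th j <= om j l).

Let A := {ffun 'I_n -> X}.
Let B := {ffun 'I_n -> Y}.
Let bins := {ffun 'I_M -> {ffun L -> A}}.
Let P j : A -> R := @word_input R X (p j) n.
Let V j k : A -> B -> R := @word_chan R X Y (out_marg W j k) n.
Let Q j k : B -> R := outlaw (P j) (V j k).
Let mix j k : {ffun L -> A} -> B -> R := mixlaw (V j k) (om j).
Let PU1 j (v : {ffun L -> A}) : R := \prod_l P j (v l).

Definition bins_law (u : bins) : R := \prod_j PU1 j (u j).
Definition bins_chan (k : 'I_K.+1) (u : bins) (b : obsword Y M n) : R :=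
  \prod_j mix j k (u j) (b j).
(** Likelihood ratio of a bin against the average output law, restricted to the channels of [J]. *)
Definition bins_score (J : pred 'I_M) (k : 'I_K.+1) (u : bins) (b : obsword Y M n) : R :=
  \prod_j (if J j then mix j k (u j) (b j) / Q j k (b j) else 1).
(** Divergence of the eavesdropper's output, given the message, from the product of the laws
    [Q j (eve K)]; the sum of logarithms keeps the channels apart for averaging. *)
Definition bins_leak (u : bins) : R :=
  \sum_z bins_chan (eve K) u z * \sum_j ln (mix j (eve K) (u j) (z j) / Q j (eve K) (z j)).
Definition bins_enc (u : bins) : {ffun inword X M n -> R} :=
  [ffun x : inword X M n => \prod_j \sum_l om j l * (x j == u j l)%:R].

Let pp0 j x : 0 <= p j x. Proof. by case: (hp j). Qed.
Let pp1 j : \sum_x p j x = 1. Proof. by case: (hp j). Qed.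
Let om_ge0 j k x b : 0 <= out_marg W j k x b. Proof. exact: out_marg_ge0. Qed.
Let om_sum1 j k x : \sum_b out_marg W j k x b = 1. Proof. exact: out_marg_sum1. Qed.
Let P0 j a : 0 <= P j a. Proof. exact: word_input_ge0. Qed.
Let P1 j : \sum_a P j a = 1. Proof. exact: word_input_sum1. Qed.
Let V0 j k a b : 0 <= V j k a b. Proof. exact: word_chan_ge0. Qed.
Let V1 j k a : \sum_b V j k a b = 1. Proof. exact: word_chan_sum1. Qed.
Let Q0 j k b : 0 <= Q j k b. Proof. exact: outlaw_ge0. Qed.
Let mix0 j k v b : 0 <= mix j k v b. Proof. exact: mixlaw_ge0. Qed.
Let mix1 j k v : \sum_b mix j k v b = 1. Proof. exact: mixlaw_sum1. Qed.
Let PU10 j v : 0 <= PU1 j v. Proof. exact: prodr_ge0. Qed.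
Let PU11 j : \sum_v PU1 j v = 1. Proof. exact: (sum_prod1 (fun=> P1 j)). Qed.

Lemma bins_law_ge0 u : 0 <= bins_law u. Proof. exact: prodr_ge0. Qed.
Lemma bins_law_sum1 : \sum_u bins_law u = 1. Proof. exact: (sum_prod1 PU11). Qed.
Lemma bins_chan_ge0 k u b : 0 <= bins_chan k u b. Proof. exact: prodr_ge0. Qed.
Lemma bins_chan_sum1 k u : \sum_b bins_chan k u b = 1.
Proof. exact: (sum_prod1 (p := fun j => mix j k (u j)) (fun j => mix1 j k (u j))). Qed.
Lemma bins_score_ge0 J k u b : 0 <= bins_score J k u b.
Proof. by apply: prodr_ge0 => j _; case: ifP => // _; rewrite divr_ge0. Qed.

(** The mixture averages over the codebook to [Q], so each factor in [J] has mean 1, or 0 where [Q]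
    vanishes. *)
Lemma bins_score_mean J k b : \sum_u bins_law u * bins_score J k u b <= 1.
Proof.
rewrite (expect_prod PU1 (fun j v => if J j then mix j k v (b j) / Q j k (b j) else 1)).
apply: Num.Theory.prodr_ile1 => j _; case: (J j).
  have -> : \sum_v PU1 j v * (mix j k v (b j) / Q j k (b j)) = Q j k (b j) / Q j k (b j).
    under eq_bigr => v _ do rewrite mulrA.
    by rewrite -mulr_suml; congr (_ / _); exact: expect_mixlaw.
  have [->|nz] := eqVneq (Q j k (b j)) 0; first by rewrite mul0r lexx ler01.
  by rewrite divff // ler01 lexx.
have -> : \sum_v PU1 j v * 1 = 1 by rewrite -mulr_suml PU11 mul1r.
by rewrite ler01 lexx.
Qed.

Lemma bins_enc_pmf u : is_pmf (bins_enc u).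
Proof.
split=> [x|].
  rewrite ffunE; apply: prodr_ge0 => j _; apply: sumr_ge0 => l _.
  by rewrite mulr_ge0 ?ler0n.
under eq_bigr => x _ do rewrite ffunE.
rewrite -(bigA_distr_bigA (fun j (a : A) => \sum_l om j l * (a == u j l)%:R)) /=.
rewrite big1 // => j _; rewrite exchange_big /= -[RHS](om1 j); apply: eq_bigr => l _.
rewrite -mulr_sumr (bigD1 (u j l)) //= eqxx [X in _ + X]big1 ?addr0 ?mulr1 // => a /negPf -> //.
Qed.

Lemma bins_enc_chan k u z :
  \sum_x bins_enc u x * obs_law W k x z = bins_chan k u z.
Proof.
under eq_bigr => x _ do rewrite ffunE -big_split /=.
rewrite -(bigA_distr_bigA (fun j (a : A) => (\sum_l om j l * (a == u j l)%:R) * V j k a (z j))) /=.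
apply: eq_bigr => j _.
under eq_bigr => a _ do rewrite mulr_suml.
rewrite exchange_big /=; apply: eq_bigr => l _.
rewrite (bigD1 (u j l)) //= eqxx mulr1 [X in _ + X]big1 ?addr0 // => a /negPf ->.
by rewrite mulr0 mul0r.
Qed.

(** A bin scores at least as much as the word sent from it, which has weight [th j]. The rest of the
    bin then averages out, and the sent words are independent by [pushforward_select]. *)
Lemma bins_miss (J : pred 'I_M) k (T : R) :
  \sum_u \sum_b bins_law u * bins_chan k u b * (bins_score J k u b <= T)%R%:R <=
  \sum_(x : inword X M n) \sum_(b : obsword Y M n)
    (\prod_j P j (x j)) * (\prod_j V j k (x j) (b j)) *
    ((\prod_j (if J j then th j * V j k (x j) (b j) / Q j k (b j) else 1)) <= T)%R%:R.
Proof.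
pose Ind (x : inword X M n) (b : obsword Y M n) : R :=
  ((\prod_j (if J j then th j * V j k (x j) (b j) / Q j k (b j) else 1)) <= T)%R%:R.
apply: (@le_trans _ _ (\sum_(u : bins) \sum_(b : obsword Y M n) \sum_(sel : {ffun 'I_M -> L})
    bins_law u * ((\prod_j om j (sel j)) * (\prod_j V j k (u j (sel j)) (b j)) *
      Ind [ffun j => u j (sel j)] b))).
  apply: ler_sum => u _; apply: ler_sum => b _.
  rewrite -mulrA -mulr_sumr ler_wpM2l ?bins_law_ge0 //.
  rewrite /bins_chan /mix /mixlaw bigA_distr_bigA mulr_suml; apply: ler_sum => sel _.
  rewrite big_split /=.
  have [->|nz] := eqVneq (\prod_j om j (sel j)) 0; first by rewrite !mul0r.
  have omp j : 0 < om j (sel j).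
    by rewrite lt_def om0 andbT; move/prodf_neq0: nz; apply.
  rewrite ler_wpM2l //; first by rewrite mulr_ge0 //; apply: prodr_ge0.
  rewrite /Ind ler_nat.
  have [le|] := leP (bins_score J k u b) T => //.
  rewrite (le_trans _ le) //; apply: ler_prod => j _; rewrite ffunE.
  case: ifP => _; last by rewrite ler01 lexx.
  rewrite divr_ge0 ?mulr_ge0 ?(ltW (th0 j)) //= ler_wpM2r ?invr_ge0 //.
  apply: le_trans (ler_wpM2r _ (thom (omp j))) _ => //.
  by rewrite /mix /mixlaw (bigD1 (sel j)) //= lerDl sumr_ge0 // => l _; rewrite mulr_ge0.
rewrite le_eqVlt; apply/orP; left; apply/eqP.
rewrite exchange_big /= [RHS]exchange_big /=; apply: eq_bigr => b _.
rewrite exchange_big /=.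
transitivity (\sum_(sel : {ffun 'I_M -> L}) (\prod_j om j (sel j)) *
   \sum_(x : inword X M n) (\prod_j P j (x j)) * ((\prod_j V j k (x j) (b j)) * Ind x b)).
  apply: eq_bigr => sel _.
  rewrite -(pushforward_select sel
    (fun x : inword X M n => (\prod_j V j k (x j) (b j)) * Ind x b) P1).
  rewrite mulr_sumr; apply: eq_bigr => u _.
  rewrite -mulrA mulrCA; congr (_ * (_ * (_ * _))).
  by apply: eq_bigr => j _; rewrite ffunE.
rewrite -mulr_suml (sum_prod1 om1) mul1r.
by apply: eq_bigr => x _; rewrite mulrA.
Qed.

Let Imi j k := mutual_info (p j) (out_marg W j k).
Let dev j k (a : A) (b : B) : R := \sum_t info_dev (p j) (out_marg W j k) (a t) (b t).

(** After taking logarithms, the event forces the total deviation over [J] to be at most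
    [- (n%:R * del)], and Chebyshev's inequality applies. Channels outside [J] are given deviation
    0. *)
Lemma miss_chebyshev (J : pred 'I_M) k (T del : R) : 0 < T -> 0 < del ->
  ln T - \sum_(j | J j) ln (th j) <= n%:R * (\sum_(j | J j) Imi j k) - n%:R * del ->
  \sum_(x : inword X M n) \sum_(b : obsword Y M n)
    (\prod_j P j (x j)) * (\prod_j V j k (x j) (b j)) *
    ((\prod_j (if J j then th j * V j k (x j) (b j) / Q j k (b j) else 1)) <= T)%R%:R <=
  (\sum_j info_var (p j) (out_marg W j k)) / (n%:R * del ^+ 2).
Proof.
move=> T0 del0 hT.
have nd0 : 0 < n%:R * del by rewrite mulr_gt0 ?ltr0n.
pose F j a b := if J j then dev j k a b else 0.
apply: (@le_trans _ _ (\sum_(x : inword X M n) \sum_(b : obsword Y M n)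
    (\prod_j P j (x j)) * (\prod_j V j k (x j) (b j)) *
   ((\sum_j F j (x j) (b j)) ^+ 2) / (n%:R * del) ^+ 2)).
  apply: ler_sum => x _; apply: ler_sum => b _.
  have [->|nz] := eqVneq ((\prod_j P j (x j)) * (\prod_j V j k (x j) (b j))) 0.
    by rewrite !mul0r.
  rewrite -[X in _ <= X]mulrA; apply: ler_wpM2l; first by apply: mulr_ge0; apply: prodr_ge0.
  have [le|_] /= := leP _ T; last by rewrite divr_ge0 // sqr_ge0.
  have wi j : P j (x j) * V j k (x j) (b j) != 0.
    move: nz; rewrite !mulf_eq0 !negb_or => /andP[/prodf_neq0 h1 /prodf_neq0 h2].
    by rewrite h1 ?h2.
  have winfo j := word_info (pp0 j) (om_ge0 j k) (wi j).
  rewrite ler_pdivlMr ?exprn_gt0 // mul1r.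
  have pos j : 0 < th j * V j k (x j) (b j) / Q j k (b j).
    by case: (winfo j) => v q _; rewrite divr_gt0 ?mulr_gt0.
  rewrite -big_mkcond /= -ler_ln ?posrE // in le; last exact: prodr_gt0.
  rewrite ln_prod // in le.
  rewrite (eq_bigr (fun j => ln (th j) + (n%:R * Imi j k + dev j k (x j) (b j)))) in le; last first.
    by move=> j _; case: (winfo j) => v q <-; rewrite -lnM ?posrE ?divr_gt0 // mulrA.
  rewrite !big_split /= -mulr_sumr in le.
  have E : \sum_j F j (x j) (b j) = \sum_(j | J j) dev j k (x j) (b j) by rewrite [RHS]big_mkcond.
  rewrite -E in le; set S := \sum_j F _ _ _ in le *.
  have S1 : S <= - (n%:R * del) by lra.
  by rewrite -[S ^+ 2]sqrrN ler_sqr ?nnegrE; lra.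
under eq_bigr => x _ do rewrite -mulr_suml.
rewrite -mulr_suml (variance_joint P1 (fun j => V1 j k)); last first.
  move=> j; rewrite /F; case: (J j); first exact: word_dev_mean0.
  by rewrite big1 // => a _; rewrite big1 // => b _; rewrite mulr0.
apply: (@le_trans _ _ ((\sum_j n%:R * info_var (p j) (out_marg W j k)) / (n%:R * del) ^+ 2)).
  rewrite ler_wpM2r ?invr_ge0 ?sqr_ge0 //; apply: ler_sum => j _.
  rewrite /F; case: (J j); first by rewrite word_dev_var.
  rewrite big1 ?mulr_ge0 ?ler0n ?info_var_ge0 // => a _; rewrite big1 // => b _.
  by rewrite expr0n /= mulr0.
rewrite -mulr_sumr le_eqVlt; apply/orP; left; apply/eqP; field.
by rewrite pnatr_eq0 -lt0n n0 gt_eqF.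
Qed.

Lemma bins_leak_mean (eta : R) : 0 < eta ->
  (forall j, th j <= expR (- (n%:R * Imi j (eve K)))) ->
  \sum_u bins_law u * bins_leak u <=
  \sum_j (ln 2 + n%:R * eta + info_var (p j) (out_marg W j (eve K)) / eta).
Proof.
move=> eta0 hth.
under eq_bigr => u _ do rewrite mulr_sumr.
under eq_bigr => u _ do under eq_bigr => z _ do rewrite mulrA mulr_sumr.
under eq_bigr => u _ do rewrite exchange_big /=.
rewrite exchange_big /=; apply: ler_sum => j _.
rewrite (expect_joint_coord PU11 (fun j => mix1 j (eve K)) j
  (fun v b => ln (mix j (eve K) v b / Q j (eve K) b))).
apply: le_trans (covering_rate (pp0 j) (pp1 j) (om_ge0 j (eve K)) (om_sum1 j (eve K)) n0 eta0
   (th := th j) _); last by rewrite ltW //=.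
apply: le_trans (soft_covering (P0 j) (P1 j) (V0 j (eve K)) (om0 j) (om1 j) (omth j)).
apply: ler_sum => v _; rewrite mulr_sumr; apply: ler_sum => b _.
by rewrite mulrA.
Qed.

Let mix_support j k v b : 0 < PU1 j v -> 0 < mix j k v b -> 0 < Q j k b.
Proof.
move=> pv mv; rewrite /Q -(expect_mixlaw (V j k) (P1 j) (om1 j)).
apply: (sum_gt0_term (i := v)); last by rewrite mulr_gt0.
by move=> v'; apply: mulr_ge0; [exact: PU10 | exact: mixlaw_ge0].
Qed.

Let bins_support k u z : 0 < bins_law u -> bins_chan k u z != 0 ->
  forall j, 0 < mix j k (u j) (z j) /\ 0 < Q j k (z j).
Proof.
move=> pu; move/prodf_neq0 => nz j.
have mj : 0 < mix j k (u j) (z j) by rewrite lt_def nz // mix0.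
split=> //; apply: (@mix_support j k (u j)) => //.
by rewrite lt_def PU10 andbT; move: (lt0r_neq0 pu) => /prodf_neq0; apply.
Qed.

Let QQ (z : obsword Y M n) : R := \prod_j Q j (eve K) (z j).

Let QQ0 z : 0 <= QQ z. Proof. exact: prodr_ge0. Qed.
Let QQ1 : \sum_z QQ z = 1.
Proof. by apply: (sum_prod1 (p := fun j => Q j (eve K))) => j; exact: outlaw_sum1. Qed.

Let leak_term u z : 0 < bins_law u -> bins_chan (eve K) u z != 0 ->
  [/\ 0 < bins_chan (eve K) u z, 0 < QQ z &
  \sum_j ln (mix j (eve K) (u j) (z j) / Q j (eve K) (z j)) =
  ln (bins_chan (eve K) u z / QQ z)].
Proof.
move=> pu nz; have h := bins_support pu nz.
have b0 : 0 < bins_chan (eve K) u z by rewrite lt_def nz bins_chan_ge0.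
have q0 : 0 < QQ z by apply: prodr_gt0 => j _; case: (h j).
split=> //; rewrite ln_div ?posrE // /bins_chan /QQ !ln_prod; [|by move=> j _; case: (h j)..].
by rewrite -sumrB; apply: eq_bigr => j _; case: (h j) => m q; rewrite ln_div ?posrE.
Qed.

(** Nonnegativity of a divergence; it allows the leakage to be dropped from the common bound when
    the errors are estimated. *)
Lemma bins_leak_ge0 u : 0 < bins_law u -> 0 <= bins_leak u.
Proof.
move=> pu; rewrite -oppr_le0.
apply: le_trans (sum_ln_le0 (p := bins_chan (eve K) u)
    (r := fun z => QQ z / bins_chan (eve K) u z) _ _ _).
- rewrite -sumrN; apply: ler_sum => z _.
  have [->|nz] := eqVneq (bins_chan (eve K) u z) 0; first by rewrite !mul0r oppr0.
  have [b0 q0 ->] := leak_term pu nz.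
  by rewrite -mulrN -lnV ?posrE ?divr_gt0 // invf_div.
- exact: bins_chan_ge0.
- by move=> z /lt0r_neq0/(leak_term pu)[b0 q0 _]; rewrite divr_gt0.
- rewrite bins_chan_sum1 -QQ1; apply: ler_sum => z _.
  have [->|nz] := eqVneq (bins_chan (eve K) u z) 0; first by rewrite !mul0r.
  by rewrite mulrC divfK.
Qed.

(** * Errors and equivocation of a fixed codebook *)

Section Codebook.
Variables (N : nat) (c : 'I_N -> bins).
Hypotheses (N0 : (0 < N)%N) (hc : forall w, 0 < bins_law (c w)).

Lemma msg_eve_bins w z :
  msg_eve W (fun w => bins_enc (c w)) w z = N%:R^-1 * bins_chan (eve K) (c w) z.
Proof.
rewrite msg_eveE -bins_enc_chan mulr_sumr.
by apply: eq_bigr => x _; rewrite mulrA.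
Qed.

Lemma err_prob_bins (dec : 'I_K -> obsword Y M n -> 'I_N) i :
  err_prob W (fun w => bins_enc (c w)) dec i =
  N%:R^-1 * \sum_w \sum_b (dec i b != w)%:R * bins_chan (rcv i) (c w) b.
Proof.
rewrite mulr_sumr; apply: eq_bigr => w _.
under [in RHS]eq_bigr => b _ do rewrite -bins_enc_chan mulr_sumr.
rewrite [X in _ = _ * X]exchange_big /= mulr_sumr; apply: eq_bigr => x _.
under [in RHS]eq_bigr => b _ do rewrite mulrCA [_%:R * _]mulrC.
rewrite -mulr_sumr -(sum_chan_n_obs W (rcv i) x (fun b => (dec i b != w)%:R)) !mulr_sumr.
by apply: eq_bigr => y _; rewrite /code_joint; case: ifP; rewrite ?mulr1 ?mulr0 ?mulrA.
Qed.

(** The leaked information is at most the mean divergence of the conditional output laws from any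
    fixed law. That law is [QQ], and Gibbs' inequality for [QQ / pz] makes the comparison. *)
Lemma equivocation_bins :
  ln N%:R - N%:R^-1 * \sum_w bins_leak (c w) <=
  condH (msg_eve W (fun w => bins_enc (c w))) * ln 2.
Proof.
have Ngt0 : 0 < N%:R :> R by rewrite ltr0n.
pose m w z := N%:R^-1 * bins_chan (eve K) (c w) z.
pose pz z := \sum_w m w z.
have m0 w z : 0 <= m w z by rewrite mulr_ge0 ?invr_ge0 ?ler0n ?bins_chan_ge0.
have m1 : \sum_w \sum_z m w z = 1.
  under eq_bigr => w _ do rewrite -mulr_sumr bins_chan_sum1.
  exact: sum_msg.
have pos w z : m w z != 0 -> [/\ 0 < m w z, 0 < pz z, 0 < bins_chan (eve K) (c w) z & 0 < QQ z].
  move=> nz; have mm : 0 < m w z by rewrite lt_def nz m0.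
  move: nz; rewrite mulf_eq0 negb_or => /andP[_ /(leak_term (hc w))[b0 q0 _]].
  by split=> //; apply: (sum_gt0_term (i := w)).
have HE : condH (msg_eve W (fun w => bins_enc (c w))) * ln 2 =
    \sum_w \sum_z m w z * ln (pz z / m w z).
  rewrite /condH mulNr mulr_suml -sumrN; apply: eq_bigr => w _.
  rewrite mulr_suml -sumrN; apply: eq_bigr => z _.
  rewrite msg_eve_bins -/(m w z).
  have -> : \sum_w' msg_eve W (fun w => bins_enc (c w)) w' z = pz z.
    by apply: eq_bigr => w' _; rewrite msg_eve_bins.
  case: eqP => [->|/eqP nz]; first by rewrite !mul0r oppr0.
  have [mm pp _ _] := pos _ _ nz.
  by rewrite /log2 -mulrA divfK ?gt_eqF ?ln2_gt0 // -mulrN -lnV ?posrE ?divr_gt0 // invf_div.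
rewrite HE lerBlDl -subr_le0.
apply: le_trans (sum_ln_le0 (p := fun wz : 'I_N * obsword Y M n => m wz.1 wz.2)
    (r := fun wz => QQ wz.2 / pz wz.2) _ _ _).
- rewrite -(pair_big predT predT (fun w z => m w z * ln (QQ z / pz z))) /=.
  rewrite -[ln N%:R]mul1r -[X in X * _ - _]m1 mulr_suml mulr_sumr -big_split -sumrB /=.
  apply: ler_sum => w _; rewrite /bins_leak mulr_suml mulr_sumr -big_split -sumrB /=.
  apply: ler_sum => z _; rewrite mulrA -/(m w z).
  have [->|nz] := eqVneq (m w z) 0; first by rewrite !mul0r addr0 subr0.
  have [mm pp b0 q0] := pos _ _ nz.
  have [_ _ ->] := leak_term (hc w) (lt0r_neq0 b0).
  rewrite -mulrDr -mulrBr ler_wpM2l // /m.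
  rewrite !ln_div ?posrE ?mulr_gt0 ?invr_gt0 // lnM ?posrE ?invr_gt0 // lnV ?posrE //.
  lra.
- by move=> [w z] /=.
- by move=> [w z] /= /lt0r_neq0/pos[mm pp b0 q0]; rewrite divr_gt0.
- rewrite -(pair_big predT predT m) /= m1.
  rewrite -(pair_big predT predT (fun w z => m w z * (QQ z / pz z))) /=.
  rewrite exchange_big /= -[X in _ <= X]QQ1.
  apply: ler_sum => z _; rewrite -mulr_suml -/(pz z).
  have [->|nz] := eqVneq (pz z) 0; first by rewrite mul0r.
  by rewrite mulrC divfK.
Qed.

End Codebook.

(** The errors and the leakage over [n] share one bound; all summands are nonnegative, so each
    inherits it. *)
Lemma binned_code (N : nat) (J : 'I_K -> pred 'I_M) (T del eta bound : R) :
  (0 < N)%N -> 0 < T -> 0 < del -> 0 < eta ->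
  (forall i, ln T - \sum_(j | J i j) ln (th j) <=
     n%:R * (\sum_(j | J i j) mutual_info (p j) (out_marg W j (rcv i))) - n%:R * del) ->
  (forall j, th j <= expR (- (n%:R * mutual_info (p j) (out_marg W j (eve K))))) ->
  \sum_i ((\sum_j info_var (p j) (out_marg W j (rcv i))) / (n%:R * del ^+ 2) + N.-1%:R / T) +
    n%:R^-1 * \sum_j (ln 2 + n%:R * eta + info_var (p j) (out_marg W j (eve K)) / eta) <= bound ->
  exists (enc : 'I_N -> {ffun inword X M n -> R}) (dec : 'I_K -> obsword Y M n -> 'I_N),
    [/\ forall w, is_pmf (enc w), forall i, err_prob W enc dec i <= bound &
        ln N%:R - n%:R * bound <= condH (msg_eve W enc) * ln 2].
Proof.
move=> N0 T0 del0 eta0 hJ hth hb.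
have ngt0 : 0 < n%:R :> R by rewrite ltr0n.
have [c [dec [hc le]]] := random_coding (PU := bins_law) bins_law_ge0 bins_law_sum1
  (V := fun i u b => bins_chan (rcv i) u b)
  (s := fun i u b => bins_score (J i) (rcv i) u b)
  (fun u => n%:R^-1 * bins_leak u) N0 (fun i => bins_chan_ge0 (rcv i))
  (fun i => bins_chan_sum1 (rcv i)) (fun i => bins_score_ge0 (J i) (rcv i))
  (fun i => bins_score_mean (J i) (rcv i)) T0.
exists (fun w => bins_enc (c w)), dec.
have {}le : \sum_i err_prob W (fun w => bins_enc (c w)) dec i +
    n%:R^-1 * (N%:R^-1 * \sum_w bins_leak (c w)) <= bound.
  apply: le_trans hb; apply: le_trans (le_trans _ le) _.
    rewrite le_eqVlt; apply/orP; left; apply/eqP; congr (_ + _).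
      by apply: eq_bigr => i _; rewrite err_prob_bins.
    by rewrite -mulr_sumr mulrCA.
  rewrite lerD //.
    apply: ler_sum => i _; rewrite lerD2r; apply: le_trans (bins_miss _ _ _) _.
    exact: miss_chebyshev.
  under eq_bigr => u _ do rewrite mulrCA.
  by rewrite -mulr_sumr ler_wpM2l ?invr_ge0 ?(ltW ngt0) // bins_leak_mean.
have l0 : 0 <= n%:R^-1 * (N%:R^-1 * \sum_w bins_leak (c w)).
  rewrite !mulr_ge0 ?invr_ge0 ?ler0n // sumr_ge0 // => w _.
  exact: bins_leak_ge0.
have e0 i : 0 <= err_prob W (fun w => bins_enc (c w)) dec i.
  rewrite err_prob_bins mulr_ge0 ?invr_ge0 ?ler0n //.
  by do 2 (apply: sumr_ge0 => ? _); rewrite mulr_ge0 ?ler0n ?bins_chan_ge0.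
split=> [w|i|]; first exact: bins_enc_pmf.
  by apply: le_trans le; rewrite (bigD1 i) //= -addrA lerDl addr_ge0 // sumr_ge0.
apply: le_trans (equivocation_bins N0 hc); rewrite lerD2l lerN2.
by rewrite -ler_pdivrMl //; apply: le_trans le; rewrite lerDr sumr_ge0.
Qed.

End BinnedCode.

(** * The capacity *)

Section NatCeil.
Variable R : realType.

(** A union bound over [N] messages has [N.-1] competitors, hence the bound on the predecessor:
    rounding up then costs nothing. *)
Lemma natceil (x : R) : 0 < x ->
  [/\ (0 < `|Num.ceil x|)%N, x <= `|Num.ceil x|%N%:R & `|Num.ceil x|%N.-1%:R <= x].
Proof.
move=> x0; have c0 : 0 < Num.ceil x by rewrite ceil_gt0.
have /andP[lt le] := ceil_itv x.
case: (Num.ceil x) c0 lt le => // m m0 lt le /=.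
split=> //.
case: m m0 lt le => // m _ + _ /=.
by rewrite -addn1 PoszD addrK -pmulrn => /ltW.
Qed.

(** The absolute value covers negative [y], where the ceiling is still 1. *)
Lemma natceil_ln (y : R) : ln `|Num.ceil (expR y)|%N%:R <= `|y| + ln 2.
Proof.
have [m0 le1 le2] := natceil (expR_gt0 y).
have mE : `|Num.ceil (expR y)|%N%:R = `|Num.ceil (expR y)|%N.-1%:R + 1 :> R.
  by rewrite natr1 prednK.
rewrite -[`|y|]expRK -lnM ?posrE ?expR_gt0 // ler_ln ?posrE ?ltr0n ?mulr_gt0 ?expR_gt0 //.
rewrite mE mulr_natr mulr2n lerD //.
  by apply: le_trans le2 _; rewrite ler_expR ler_norm.
by rewrite -[X in X <= _]expR0 ler_expR.
Qed.

Lemma nmsgE (n : nat) (r : R) : nmsg n r = `|Num.ceil (expR (n%:R * (r * ln 2)))|%N.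
Proof. by rewrite /nmsg /powR pnatr_eq0 /= mulrA. Qed.

End NatCeil.

Section Capacity.
Variables (R : realType) (X Y : finType) (K M : nat) (W : channel R X Y K M).
Hypotheses (K0 : (0 < K)%N) (M0 : (0 < M)%N) (hW : is_channel W).

Lemma achievable_lt_objective (p : 'I_M -> {ffun X -> R}) (r : R) :
  rev_degraded W -> (forall j, is_pmf (p j)) -> r < secrecy_objective W p ->
  achievable W r.
Proof.
move=> hD hp hr eps eps0.
have l2 := ln2_gt0 R.
have l2le : ln 2 <= 1 :> R by have := @ln_le_sub1 R 2; lra.
pose Ie j := mutual_info (p j) (out_marg W j (eve K)).
pose Ii j i := mutual_info (p j) (out_marg W j (rcv i)).
(* Positivity excludes the vanishing alternative of [condMI_rev_degraded], so the difference formula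
   holds on [J i]; the discarded terms are not positive. *)
pose J i j := 0 < condMI (joint_xyz W j (p j) i).
(* A third of the gap, in nats: one share for the threshold [T], one for Chebyshev's inequality, one
   for rounding the bin sizes. *)
pose del := (secrecy_objective W p - r) * ln 2 / 3.
have del0 : 0 < del by rewrite divr_gt0 ?mulr_gt0 ?subr_gt0.
have gap i : r * ln 2 + 3 * del <= \sum_(j | J i j) Ii j i - \sum_(j | J i j) Ie j.
  have -> : r * ln 2 + 3 * del = secrecy_objective W p * ln 2 by rewrite /del; field.
  apply: le_trans (ler_wpM2r (ltW l2) (minI_le _ i)) _.
  rewrite -sumrB (bigID (J i)) /= mulrDl.
  rewrite -[X in _ <= X]addr0 lerD //; last first.
    by rewrite pmulr_lle0 // sumr_le0 // => j; rewrite /J -leNgt.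
  rewrite mulr_suml; apply: ler_sum => j Jj.
  case: (condMI_rev_degraded j i hW hD (hp j)) => [z|->] //.
  by move: Jj; rewrite /J z ltxx.
(* The equivocation, converted to bits, requires [eps * ln 2]; the error only requires [eps], which
   is larger. *)
pose e := eps * ln 2; have e0 : 0 < e by rewrite mulr_gt0.
have ee : e <= eps by rewrite ler_piMr // ltW.
have Mgt0 : 0 < M%:R :> R by rewrite ltr0n.
(* The terms in [n%:R * eta] cost [M%:R * eta], half of the budget [e]; [D] collects what decays
   like [n^-1] and takes the other half. *)
pose eta := e / (2 * M%:R); have eta0 : 0 < eta by rewrite divr_gt0 ?mulr_gt0.
pose D := \sum_i ((\sum_j info_var (p j) (out_marg W j (rcv i))) / del ^+ 2 + del^-1) +
   \sum_j (ln 2 + info_var (p j) (out_marg W j (eve K)) / eta).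
have iv0 j k : 0 <= info_var (p j) (out_marg W j k).
  by apply: info_var_ge0 => [x|x b]; [case: (hp j) | exact: out_marg_ge0].
have D0 : 0 <= D.
  apply: addr_ge0; apply: sumr_ge0 => i _; apply: addr_ge0.
  - by apply: divr_ge0; [exact: sumr_ge0 | exact: sqr_ge0].
  - by rewrite invr_ge0 ltW.
  - exact: ltW.
  - by apply: divr_ge0 => //; exact: ltW.
have a0 : 0 <= 2 * D / e by apply: divr_ge0; [by rewrite pmulr_rge0 | exact: ltW].
have b0 : 0 <= M%:R * ln 2 / del by apply: divr_ge0; [apply: mulr_ge0 | ]; exact: ltW.
(* The first summand brings [D / n%:R] below [e / 2]; the second lets [n%:R * del] absorb a factor 2
   per channel lost in rounding. *)
have [n n0 nbig] : exists2 n, (0 < n)%N & 2 * D / e + M%:R * ln 2 / del <= n%:R.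
  exists (Num.bound (2 * D / e + M%:R * ln 2 / del)).+1 => //.
  apply: ltW; apply: lt_trans (archi_boundP (addr_ge0 a0 b0)) _.
  by rewrite ltr_nat.
have n1 : 2 * D <= n%:R * e by rewrite -ler_pdivrMr //; lra.
have n2 : M%:R * ln 2 <= n%:R * del by rewrite -ler_pdivrMr //; lra.
have ngt0 : 0 < n%:R :> R by rewrite ltr0n.
exists n; split=> //.
pose Lj j := `|Num.ceil (expR (n%:R * Ie j) : R)|%N.
have Ljp j : [/\ (0 < Lj j)%N, expR (n%:R * Ie j) <= (Lj j)%:R &
    (Lj j).-1%:R <= expR (n%:R * Ie j)].
  exact: natceil (expR_gt0 _).
pose L := (\sum_j Lj j)%N.
have LjL j : (Lj j <= L)%N by rewrite /L (bigD1 j) //= leq_addr.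
pose th j : R := (Lj j)%:R^-1.
pose om j (l : 'I_L) : R := if (l < Lj j)%N then th j else 0.
have th0 j : 0 < th j by rewrite invr_gt0 ltr0n; case: (Ljp j).
have om0 j l : 0 <= om j l by rewrite /om; case: ifP => // _; rewrite ltW.
have om1 j : \sum_l om j l = 1.
  rewrite -big_mkcond /= -(big_ord_widen _ (fun=> th j) (LjL j)) sumr_const card_ord.
  by rewrite -[LHS]mulr_natl mulfV // pnatr_eq0 -lt0n; case: (Ljp j).
have omth j l : om j l <= th j by rewrite /om; case: ifP => // _; rewrite ltW.
have thom j l : 0 < om j l -> th j <= om j l by rewrite /om; case: ifP; rewrite ?ltxx.
have Ie0 j : 0 <= Ie j.
  by have [h0 h1] := hp j; apply: mutual_info_ge0 => // *;
    [exact: out_marg_ge0 | exact: out_marg_sum1].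
have lnth j : - ln (th j) <= n%:R * Ie j + ln 2.
  rewrite /th lnV ?posrE ?ltr0n; last by case: (Ljp j).
  rewrite opprK; apply: le_trans (natceil_ln _) _.
  by rewrite ger0_norm // mulr_ge0.
have thexp j : th j <= expR (- (n%:R * Ie j)).
  by rewrite expRN /th lef_pV2 ?posrE ?expR_gt0 ?ltr0n; case: (Ljp j).
pose T := expR (n%:R * (r * ln 2 + del)).
have [Np Nge Nle] := natceil (expR_gt0 (n%:R * (r * ln 2))).
rewrite -nmsgE in Np Nge Nle.
have hJ i : ln T - \sum_(j | J i j) ln (th j) <=
     n%:R * (\sum_(j | J i j) Ii j i) - n%:R * del.
  have s1 : - \sum_(j | J i j) ln (th j) <= n%:R * (\sum_(j | J i j) Ie j) + M%:R * ln 2.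
    rewrite -sumrN mulr_sumr.
    apply: le_trans (ler_sum _ (fun j _ => lnth j)) _.
    rewrite big_split /= lerD2l.
    apply: le_trans (_ : \sum_(j < M) ln 2 <= _); last by rewrite sumr_const card_ord mulr_natl.
    by rewrite big_mkcond /=; apply: ler_sum => j _; case: ifP => // _; rewrite ltW.
  have := ler_wpM2l (ltW ngt0) (gap i).
  rewrite /T expRK; lra.
have hb : \sum_i ((\sum_j info_var (p j) (out_marg W j (rcv i))) / (n%:R * del ^+ 2) +
      (nmsg n r).-1%:R / T) +
    n%:R^-1 * \sum_j (ln 2 + n%:R * eta + info_var (p j) (out_marg W j (eve K)) / eta) <= e.
  (* Through [expR (- x) <= x^-1], the exponential decay is weakened to the order [n^-1] of the
     other terms. *)
  have NT : (nmsg n r).-1%:R / T <= del^-1 / n%:R.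
    apply: le_trans (_ : expR (- (n%:R * del)) <= _).
      rewrite ler_pdivrMr ?expR_gt0 // -expRD; apply: le_trans Nle _.
      by rewrite ler_expR; lra.
    rewrite -invfM expRN lef_pV2 ?posrE ?expR_gt0 ?(mulr_gt0 del0 ngt0) //.
    by have := expR_ge1Dx (n%:R * del); rewrite [del * _]mulrC; lra.
  apply: (@le_trans _ _ (D / n%:R + M%:R * eta)); last first.
    rewrite (_ : M%:R * eta = e / 2); last by rewrite /eta; field; rewrite gt_eqF.
    suff : D / n%:R <= e / 2 by lra.
    by rewrite ler_pdivrMr //; lra.
  rewrite /D [X in _ <= X + _]mulrDl -[X in _ <= X]addrA lerD //.
    rewrite mulr_suml; apply: ler_sum => i _; rewrite [X in _ <= X]mulrDl lerD //.
    by rewrite invfM mulrA mulrAC.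
  rewrite big_split big_split /= [in X in _ <= X]big_split /= !sumr_const !card_ord.
  rewrite le_eqVlt; apply/orP; left; apply/eqP.
  rewrite -(mulr_natl (n%:R * eta)); field; rewrite gt_eqF //.
have [enc [dec [h1 h2 h3]]] :=
  binned_code hW hp n0 om0 om1 th0 omth thom Np (expR_gt0 _) del0 eta0 hJ thexp hb.
exists enc, dec; split=> //; split=> [i|]; first exact: le_trans (h2 i) ee.
rewrite ler_pdivlMr // -(ler_pM2r l2).
apply: le_trans h3.
have : n%:R * (r * ln 2) <= ln (nmsg n r)%:R.
  by rewrite -[X in X <= _]expRK ler_ln ?posrE ?expR_gt0 ?ltr0n.
rewrite /e; nra.
Qed.

Lemma achievable_le_objective (C r : R) :
  (forall p : 'I_M -> {ffun X -> R}, (forall j, is_pmf (p j)) -> secrecy_objective W p <= C) ->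
  achievable W r -> r <= C.
Proof.
move=> hC hr; rewrite leNgt; apply/negP => Cr.
have l2 := ln2_gt0 R.
(* The excess in nats, cut in thirds: Fano's constant, the terms multiplied by [eps], and the slack
   that yields the contradiction. *)
pose gam := (r - C) * ln 2.
have gam0 : 0 < gam by rewrite mulr_gt0 ?subr_gt0.
pose del := 1 - expR (- (gam / 3)).
have hdel : 0 < del < 1.
  rewrite subr_gt0 ltrBlDr ltrDl expR_gt0 andbT -[X in _ < X]expR0 ltr_expR.
  by rewrite oppr_lt0 divr_gt0.
case/andP: (hdel) => d0 d1.
have lnd : - ln (1 - del) = gam / 3 by rewrite opprB addrC subrK expRK opprK.
(* Total factor of [eps]: Fano's logarithms, with one [ln 2] from rounding the number of messages
   and one from the slack in the equivocation. *)
pose G := `|r * ln 2| + 2 * ln 2 - ln del.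
have G0 : 0 < G.
  have : ln del <= 0 by rewrite ln_le0 // ltW.
  by have := normr_ge0 (r * ln 2); rewrite /G; lra.
pose eps := gam / (3 * G).
have eps0 : 0 < eps by apply: divr_gt0 => //; rewrite pmulr_rgt0.
have [n [n0 [enc [dec [h1 [h2 h3]]]]]] := hr eps eps0.
have ngt0 : 1 <= n%:R :> R by rewrite ler1n.
have ngt : 0 < n%:R :> R by rewrite ltr0n.
have [Np Nge Nle] := natceil (expR_gt0 (n%:R * (r * ln 2))).
have lnN := natceil_ln (n%:R * (r * ln 2)).
rewrite -nmsgE in Np Nge Nle lnN.
rewrite normrM ger0_norm ?ler0n // in lnN.
have lnN0 : 0 <= ln (nmsg n r)%:R :> R by rewrite ln_ge0 // ler1n.
have := hC _ (avg_input_pmf n0 Np h1).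
suff : C < secrecy_objective W (avg_input enc) by rewrite ltNge => /negP.
apply: (@lt_le_trans _ _ ((2 * C + r) / 3)); first by lra.
apply: le_minI => // i.
have cb := converse_bound dec hW n0 Np h1 i hdel.
rewrite lnd -mulr_suml in cb.
set S := \sum_j _ in cb *.
rewrite ler_pdivlMr // in h3.
have h3' : (r - eps) * n%:R * ln 2 <=
    gam / 3 + eps * (n%:R * `|r * ln 2| + ln 2 - ln del) + n%:R * (S * ln 2).
  apply: le_trans (ler_wpM2r (ltW l2) h3) (le_trans cb _).
  rewrite lerD2r lerD2l.
  have ld : ln del <= 0 by rewrite ln_le0 // ltW.
  apply: ler_pM => //; [|by rewrite subr_ge0 (le_trans ld lnN0)|by rewrite lerD2r].
  apply: sumr_ge0 => w _; apply: sumr_ge0 => x _; apply: sumr_ge0 => y _.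
  case: ifP => // _; rewrite /code_joint !mulr_ge0 ?invr_ge0 ?ler0n //.
    by case: (h1 w).
  by apply: prodr_ge0 => j _; apply: prodr_ge0 => t _; case: (hW j (x j t)).
have key : (r - eps) * ln 2 <= gam / 3 + eps * (`|r * ln 2| + ln 2 - ln del) + S * ln 2.
  rewrite -(ler_pM2l ngt); apply: le_trans (_ : (r - eps) * n%:R * ln 2 <= _).
    by rewrite le_eqVlt; apply/orP; left; apply/eqP; ring.
  apply: le_trans h3' _.
  (* As [n] is at least 1, the nonnegative terms free of [n] may be multiplied by it before it is
     cancelled. *)
  rewrite -subr_ge0.
  rewrite (_ : _ - _ = (n%:R - 1) * (gam / 3 + eps * (ln 2 - ln del))); last by ring.
  have ld : ln del <= 0 by rewrite ln_le0 // ltW.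
  rewrite mulr_ge0 ?subr_ge0 // addr_ge0 ?divr_ge0 ?ltW // mulr_gt0 //; lra.
have eG : eps * G = gam / 3 by rewrite /eps; field; rewrite gt_eqF.
rewrite /G /gam in eG key.
rewrite -(ler_pM2r l2); lra.
Qed.

End Capacity.

Theorem theorem1 (R : realType) (X Y : finType) (K M : nat)
  (W : channel R X Y K M) :
  (0 < K)%N -> (0 < M)%N -> (0 < #|X|)%N ->
  is_channel W -> rev_degraded W ->
  exists pstar : 'I_M -> {ffun X -> R},
    (forall j, is_pmf (pstar j)) /\
    (forall p : 'I_M -> {ffun X -> R}, (forall j, is_pmf (p j)) ->
       secrecy_objective W p <= secrecy_objective W pstar) /\
    is_secrecy_capacity W (secrecy_objective W pstar).
Proof.
move=> K0 M0 X0 hW hD.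
have [ps [hps hmax]] := objective_maximizer K0 X0 hW.
exists ps; do 2 (split => //); split=> [r|C' hC'].
  exact: achievable_le_objective.
rewrite leNgt; apply/negP => lt.
pose r := (C' + secrecy_objective W ps) / 2.
have rlt : r < secrecy_objective W ps by rewrite /r; lra.
have := hC' _ (achievable_lt_objective M0 hW hD hps rlt).
rewrite /r; lra.
Qed.
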